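(* There is a strictly convex Lipschitz function $\gamma_1:[1,2]\to\mathbb R$ whose graph $\Gamma_1=\{(x,\gamma_1(x)):x\in[1,2]\}$ satisfies \[ T(\Gamma_1)=1, \] and such that for every nondegenerate interval $I\subset[1,2]$ and every $\alpha>0$, writing \[ \sigma_I=\mathcal H^1|_{\{(x,\gamma_1(x)):x\in I\}}, \] one has \[ \limsup_{|\xi|\to\infty}|\xi|^\alpha|\widehat{\sigma_I}(\xi)|=\infty . \] In particular, no positive-length subarc of $\Gamma_1$ has pointwise Fourier decay of any positive power (for its arclength measure).
   Context: For $E,\Gamma\subset\mathbb R^2$, $E+\Gamma=\{x+y:x\in E,\ y\in\Gamma\}$, and $|\cdot|$ of a measurable set denotes Lebesgue measure (here planar). For a compact curve $\Gamma\subset\mathbb R^2$, \[ T(\Gamma)=\inf\{t:\ \dim_{\mathrm H}(E)>t\Longrightarrow|E+\Gamma|>0\ \text{ for every compact }E\subset\mathbb R^2\}, \] where $\dim_{\mathrm H}$ is Hausdorff dimension. $\mathcal H^1|_B$ is one-dimensional Hausdorff measure restricted to $B$ (arclength). For a finite Borel measure $\nu$ on $\mathbb R^2$, $\widehat\nu(\xi)=\int e^{-2\pi i x\cdot\xi}\,d\nu(x)$. Nondegenerate interval means interval of positive length. *)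

(* Defs.v *)
From HB Require Import structures.
From mathcomp Require Import all_boot all_order all_algebra.
From mathcomp Require Import all_classical all_reals all_analysis.
From mathcomp Require Import measurable_realfun lra.
From mathcomp Require Import complex.

Set Implicit Arguments.
Unset Strict Implicit.
Unset Printing Implicit Defensive.

Import Order.TTheory GRing.Theory Num.Theory.
Import numFieldNormedType.Exports.

Local Open Scope classical_set_scope.
Local Open Scope ring_scope.

(* The plane is [R * R]; its library norm is the sup norm, hence the
   separate Euclidean norm below.  The topology and the Borel sigma-algebra
   are the library ones (product structures). *)
Section euclidean_plane.
Context {R : realType}.
Implicit Types (x y : R * R) (U : set (R * R)).

Definition dotp x y : R := x.1 * y.1 + x.2 * y.2.

Definition enorm x : R := Num.sqrt (dotp x x).

(* [ediam set0 = -oo] *)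
Definition ediam U : \bar R :=
  ereal_sup [set (enorm (x - y))%:E | x in U & y in U].

Definition minkowski_sum (E F : set (R * R)) : set (R * R) :=
  [set x + y | x in E & y in F].

Definition planar_lebesgue (A : set (R * R)) : \bar R :=
  (@lebesgue_measure R \x @lebesgue_measure R)%E A.

(* neighborhoods of infinity in the plane *)
Definition enorm_infty : set_system (R * R) :=
  filter_from setT (fun M : R => [set x | M < enorm x]).

Lemma ler_enorm1 x : `|x.1| <= enorm x.
Proof.
rewrite -sqrtr_sqr /enorm /dotp ler_wsqrtr// expr2 lerDl.
by rewrite -expr2 sqr_ge0.
Qed.

Lemma ler_enorm2 x : `|x.2| <= enorm x.
Proof.
rewrite -sqrtr_sqr /enorm /dotp ler_wsqrtr// expr2 lerDr.
by rewrite -expr2 sqr_ge0.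
Qed.

Lemma ediam_ub U x y : U x -> U y -> ((enorm (x - y))%:E <= ediam U)%E.
Proof. by move=> Ux Uy; apply: ereal_sup_ubound; exists x => //; exists y. Qed.

Global Instance enorm_infty_filter : ProperFilter enorm_infty.
Proof.
apply: filter_from_proper.
- apply: filter_from_filter; first by exists 0.
  move=> M N _ _; exists (Num.max M N) => // x /=.
  by rewrite gt_max => /andP[].
- move=> M _; exists (`|M| + 1, 0) => /=.
  apply: (lt_le_trans _ (ler_enorm1 _)) => /=.
  by rewrite ger0_norm ?addr_ge0// (le_lt_trans (ler_norm M))// ltrDl.
Qed.

End euclidean_plane.

(* Hausdorff measures.  They are not renormalized: the constant that makes
   the s-dimensional measure agree with Lebesgue measure is 1 for s = 1, so
   [hausdorff 1] is arclength on curves.  The separate value at [set0] only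
   matters for s <= 0, where [0 `^ 0 = 1]. *)
Section hausdorff.
Context {R : realType}.
Local Open Scope ereal_scope.
Implicit Types (s delta : R) (A B C U : set (R * R)).

Definition diam_pow s U : \bar R :=
  if U == set0 then 0 else ediam U `^ s.

Definition delta_cover delta A : set ((set (R * R))^nat) :=
  [set U | A `<=` \bigcup_k U k /\ forall k, ediam (U k) <= delta%:E].

Definition hausdorff_pre s delta A : \bar R :=
  ereal_inf [set \sum_(k <oo) diam_pow s (U k) | U in delta_cover delta A].

Definition hausdorff s A : \bar R :=
  ereal_sup [set hausdorff_pre s delta A | delta in [set d | (0 < d)%R]].

Definition hausdorff_dim A : \bar R :=
  ereal_inf [set s%:E | s in [set s : R | (0 <= s)%R /\ hausdorff s A = 0]].

Lemma diam_pow0 s : diam_pow s set0 = 0.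
Proof. by rewrite /diam_pow eqxx. Qed.

Lemma diam_pow_ge0 s U : 0 <= diam_pow s U.
Proof. by rewrite /diam_pow; case: ifP => // _; exact: poweR_ge0. Qed.

Lemma ediam0 : ediam (@set0 (R * R)) = -oo.
Proof.
apply/eqP; rewrite -leeNy_eq; apply: ge_ereal_sup => _ [x []].
Qed.

Lemma hausdorff_pre_ge0 s delta A : 0 <= hausdorff_pre s delta A.
Proof.
apply: le_ereal_inf_tmp => _ [U _ <-].
by apply: nneseries_ge0 => k _ _; exact: diam_pow_ge0.
Qed.

Lemma hausdorff_pre_le s delta delta' A : (delta <= delta')%R ->
  hausdorff_pre s delta' A <= hausdorff_pre s delta A.
Proof.
move=> dd; apply: le_ereal_inf_tmp => _ [U [AU dU] <-].
apply: ereal_inf_lbound; exists U => //; split => // k.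
by rewrite (le_trans (dU k))// lee_fin.
Qed.

Lemma le_hausdorff_pre s delta :
  {homo hausdorff_pre s delta : A B / A `<=` B >-> A <= B}.
Proof.
move=> A B AB; apply: le_ereal_inf_tmp => _ [U [BU dU] <-].
by apply: ereal_inf_lbound; exists U => //; split => //; exact: subset_trans BU.
Qed.

Lemma hausdorff_pre0 s delta : hausdorff_pre s delta set0 = 0.
Proof.
apply/eqP; rewrite eq_le hausdorff_pre_ge0 andbT.
apply: ereal_inf_lbound; exists (fun=> set0).
  by split=> // k; rewrite ediam0 leNye.
by rewrite eseries0// => k _ _; rewrite diam_pow0.
Qed.

(* every set is measurable in [g_sigma_algebraType setT], so the covers used
   by [mu_ext] are arbitrary *)
Let hausdorff_preE s delta A : hausdorff_pre s delta A =
  @mu_ext _ (g_sigma_algebraType [set: set (R * R)]) R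
    (fun U => if ediam U <= delta%:E then diam_pow s U else +oo) A.
Proof.
apply/eqP; rewrite eq_le; apply/andP; split; apply: le_ereal_inf_tmp.
- move=> _ [U [_ AU] <-].
  have [dU|/existsNP[k /negP/negbTE kU]] :=
      pselect (forall k, ediam (U k) <= delta%:E).
    apply: ereal_inf_lbound; exists U => //.
    by apply: eq_eseriesr => k _; rewrite dU.
  rewrite (eseries_pinfty _ (k := k))// ?leey ?kU// => n _.
  case: ifP => // _.
  by rewrite -ltNye (lt_le_trans _ (diam_pow_ge0 s (U n))).
- move=> _ [U [AU dU] <-]; apply: ereal_inf_lbound; exists U.
    by split => // k; exact: sub_sigma_algebra.
  by apply: eq_eseriesr => k _; rewrite dU.
Qed.

Lemma hausdorff_pre_sigma_subadditive s delta :
  sigma_subadditive (hausdorff_pre s delta).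
Proof.
move=> F; rewrite hausdorff_preE.
rewrite (eq_eseriesr (fun k _ => hausdorff_preE s delta (F k))).
apply: (@mu_ext_sigma_subadditive _ (g_sigma_algebraType [set: set (R * R)])).
by move=> U; case: ifP => // _; exact: diam_pow_ge0.
Qed.

Lemma hausdorff_pre_ub s delta A : (0 < delta)%R ->
  hausdorff_pre s delta A <= hausdorff s A.
Proof. by move=> d0; apply: ereal_sup_ubound; exists delta. Qed.

Lemma hausdorff_ge0 s A : 0 <= hausdorff s A.
Proof.
by rewrite (le_trans (hausdorff_pre_ge0 s 1 A))// hausdorff_pre_ub.
Qed.

Lemma hausdorff0 s : hausdorff s set0 = 0.
Proof.
apply/eqP; rewrite eq_le hausdorff_ge0 andbT.
by apply: ge_ereal_sup => _ [d _ <-]; rewrite hausdorff_pre0.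
Qed.

Lemma le_hausdorff s : {homo hausdorff s : A B / A `<=` B >-> A <= B}.
Proof.
move=> A B AB; apply: ge_ereal_sup => _ [d d0 <-].
by rewrite (le_trans (le_hausdorff_pre s d AB))// hausdorff_pre_ub.
Qed.

Lemma hausdorff_sigma_subadditive s : sigma_subadditive (hausdorff s).
Proof.
move=> F; apply: ge_ereal_sup => _ [d d0 <-].
rewrite (le_trans (hausdorff_pre_sigma_subadditive s d F))//.
apply: lee_nneseries => k _; first by move=> _; exact: hausdorff_pre_ge0.
exact: hausdorff_pre_ub.
Qed.

HB.instance Definition _ s := isOuterMeasure.Build R (R * R)%type (hausdorff s)
  (hausdorff0 s) (hausdorff_ge0 s) (@le_hausdorff s)
  (@hausdorff_sigma_subadditive s).

Lemma hausdorff_pre_separated s delta delta' A B :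
  (forall x y, A x -> B y -> (delta' <= enorm (x - y))%R) ->
  (delta < delta')%R ->
  hausdorff_pre s delta A + hausdorff_pre s delta B <=
  hausdorff_pre s delta (A `|` B).
Proof.
move=> sepAB dd; apply: le_ereal_inf_tmp => _ [U [ABU dU] <-].
pose V C k := if U k `&` C == set0 then set0 else U k.
have VE C : hausdorff_pre s delta C <= \sum_(k <oo) diam_pow s (V C k) \/
    ~ (C `<=` A `|` B).
  have [CAB|] := pselect (C `<=` A `|` B); [left|by right].
  apply: ereal_inf_lbound; exists (V C) => //; split.
    move=> x Cx; have [k _ Ux] := ABU _ (CAB _ Cx); exists k => //.
    by rewrite /V; case: ifPn => // /eqP; rewrite -subset0 => /(_ x); exact.
  by move=> k; rewrite /V; case: ifPn => // _; rewrite ediam0 leNye.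
case: (VE A) => [hA|[]]; last by move=> x; left.
case: (VE B) => [hB|[]]; last by move=> x; right.
apply: (le_trans (leeD hA hB)).
rewrite -nneseriesD; [|by move=> *; exact: diam_pow_ge0..].
apply: lee_nneseries => [k _ _|k _].
  by rewrite adde_ge0// diam_pow_ge0.
rewrite /V; case: ifPn => [_|/set0P[x [Ux Ax]]].
  by rewrite diam_pow0 add0e; case: ifP => // _; rewrite diam_pow0 diam_pow_ge0.
case: ifPn => [_|/set0P[y [Uy By]]]; first by rewrite diam_pow0 adde0.
have := le_trans (ediam_ub Ux Uy) (dU k); rewrite lee_fin.
by move/(le_trans (sepAB _ _ Ax By)); rewrite leNgt dd.
Qed.

Lemma hausdorff_separated s delta A B : (0 < delta)%R ->
  (forall x y, A x -> B y -> (delta <= enorm (x - y))%R) ->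
  hausdorff s A + hausdorff s B <= hausdorff s (A `|` B).
Proof.
move=> delta0 sepAB.
have key (d1 d2 : R) : (0 < d1)%R -> (0 < d2)%R ->
    hausdorff_pre s d1 A + hausdorff_pre s d2 B <= hausdorff s (A `|` B).
  move=> d10 d20; pose d : R := (Num.min (delta / 2) (Num.min d1 d2))%R.
  have d0 : (0 < d)%R by rewrite !lt_min d10 d20 divr_gt0.
  apply: le_trans (hausdorff_pre_ub s _ d0).
  apply: le_trans (hausdorff_pre_separated s sepAB _); last first.
    by rewrite /d gt_min ltr_pdivrMr// mulr_natr mulr2n ltrDr delta0.
  by apply: leeD; apply: hausdorff_pre_le; rewrite /d !ge_min lexx ?orbT.
have [->|Xoo] := eqVneq (hausdorff s (A `|` B)) +oo; first by rewrite leey.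
have Xfin : hausdorff s (A `|` B) \is a fin_num.
  by rewrite ge0_fin_numE ?ltey// hausdorff_ge0.
have fin C : C `<=` A `|` B -> hausdorff s C \is a fin_num.
  move=> CAB; rewrite ge0_fin_numE ?hausdorff_ge0//.
  by rewrite (le_lt_trans (le_hausdorff s CAB))// ltey.
rewrite -leeBrDr; last by apply: fin; right.
apply: ge_ereal_sup => _ [d1 d10 <-].
rewrite leeBrDr; last by apply: fin; right.
have p1 : hausdorff_pre s d1 A \is a fin_num.
  rewrite ge0_fin_numE ?hausdorff_pre_ge0//.
  rewrite (le_lt_trans (hausdorff_pre_ub s A d10))//.
  by rewrite -ge0_fin_numE ?hausdorff_ge0//; apply: fin; left.
rewrite addeC -leeBrDr//; apply: ge_ereal_sup => _ [d2 d20 <-].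
by rewrite leeBrDr// addeC; exact: key.
Qed.

(* Caratheodory's criterion for the half-planes cut out by a coordinate *)
Lemma hausdorff_caratheodory_halfplane s (f : R * R -> R) (c : R) :
  (forall x y, `|f x - f y| <= enorm (x - y))%R ->
  (hausdorff s).-caratheodory [set x | (f x <= c)%R].
Proof.
move=> f_lip; pose F := [set x | (f x <= c)%R].
apply: le_caratheodory_measurable => X.
change (hausdorff s (X `&` F) + hausdorff s (X `&` ~` F) <= hausdorff s X).
have [->|Xoo] := eqVneq (hausdorff s X) +oo; first by rewrite leey.
have fin C : C `<=` X -> hausdorff s C \is a fin_num.
  move=> CX; rewrite ge0_fin_numE ?hausdorff_ge0//.
  by rewrite (le_lt_trans (le_hausdorff s CX))// ltey.
pose r j : R := (j.+1%:R^-1)%R.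
have r_gt0 j : (0 < r j)%R by rewrite invr_gt0.
have r_lt j k : (j < k)%N -> (r k < r j)%R.
  by move=> jk; rewrite ltf_pV2 ?posrE// ltr_nat ltnS.
have r_le j k : (j <= k)%N -> (r k <= r j)%R.
  by move=> jk; rewrite lef_pV2 ?posrE// ler_nat ltnS.
pose A j := X `&` [set x | (c + r j < f x)%R].
pose D j := X `&` [set x | (c + r j.+1 < f x <= c + r j)%R].
have AX j : A j `<=` X by move=> x [].
have DX j : D j `<=` X by move=> x [].
pose h C : R := fine (hausdorff s C).
have hE C : C `<=` X -> hausdorff s C = (h C)%:E by move=> /fin CX; rewrite fineK.
have sep t t' B C : (t < t')%R -> B `<=` X -> C `<=` X ->
    (forall x, B x -> (f x <= t)%R) -> (forall x, C x -> (t' <= f x)%R) ->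
    (h B + h C <= h (B `|` C))%R.
  move=> tt BX CX Bt Ct; rewrite -lee_fin EFinD -!hE//; last first.
    by move=> x [/BX|/CX].
  apply: (@hausdorff_separated _ (t' - t)%R); first by rewrite subr_gt0.
  move=> x y /Bt fx /Ct fy; apply: le_trans (f_lip x y).
  by rewrite distrC ler_normr; apply/orP; left; rewrite lerB.
have mono B C : B `<=` C -> C `<=` X -> (h B <= h C)%R.
  move=> BC CX; rewrite -lee_fin -!hE//; last exact: subset_trans CX.
  exact: le_hausdorff.
have FX : X `&` F `<=` X by move=> x [].
have CX : X `&` ~` F `<=` X by move=> x [].
have hFA j : (h (X `&` F) + h (A j) <= h X)%R.
  apply: (@le_trans _ _ (h ((X `&` F) `|` A j))); last first.
    by apply: mono => // x [[]|[]].
  apply: (@sep c (c + r j)%R) => //; first by rewrite ltrDl.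
    by move=> x [].
  by move=> x [_ /= /ltW].
have hAD j : (h (D j.+1) + h (A j) <= h (A j.+2))%R.
  apply: (@le_trans _ _ (h (D j.+1 `|` A j))); last first.
    apply: mono => // x [[Xx /= /andP[xj _]]|[Xx xj]]; split => //.
    by move: xj => /=; apply: le_lt_trans; rewrite lerD2l r_le// (leq_trans (leqnSn j)).
  apply: (@sep (c + r j.+1)%R (c + r j)%R) => //.
  - by rewrite ltrD2l r_lt.
  - by move=> x [_ /= /andP[]].
  - by move=> x [_ /= /ltW].
have hA_le j k : (j <= k)%N -> (h (A j) <= h (A k))%R.
  move=> jk; apply: mono => // x [Xx xj]; split => //.
  by move: xj => /=; apply: le_lt_trans; rewrite lerD2l r_le.
pose L := sup (range (fun j => h (A j))).
have supA : has_sup (range (fun j => h (A j))).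
  split; first by exists (h (A 0%N)); exists 0%N.
  exists (h X) => _ [j _ <-]; exact: mono.
have AL j : (h (A j) <= L)%R by apply: sup_upper_bound => //; exists j.
have LF : (L <= h X - h (X `&` F))%R.
  by apply: ge_sup; [exact: supA.1|move=> _ [j _ <-]; rewrite lerBrDl].
have hD m n : (\sum_(0 <= i < n) h (D (m + i)%N.+1) <=
    h (A (m + n)%N.+1) + h (A (m + n)%N) - h (A m) - h (A m.+1))%R.
  have aux (a b c1 d e p q : R) : (p <= b + a - c1 - d -> q + a <= e ->
    p + q <= e + b - c1 - d)%R by clear; lra.
  elim: n => [|n IH]; first by rewrite big_geq// addn0; lra.
  rewrite [in leLHS](big_nat_recr _ _ _ (leq0n n)) addnS.
  exact: aux IH (hAD (m + n)%N).
have hC m : (h (X `&` ~` F) <= L + L - h (A m))%R.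
  have cover : X `&` ~` F `<=` \bigcup_k
      (if k is i.+1 then D (m + i)%N.+1 else A m.+1).
    move=> x [Xx /= /negP]; rewrite -ltNge => cx.
    have [xm|xm] := ltP (c + r m.+1)%R (f x); first by exists 0%N.
    have : exists i, (c + r (m + i)%N.+2 < f x)%R.
      exists (Num.bound (f x - c)^-1).
      rewrite -ltrBrDl; set b := Num.bound _.
      have fc0 : (0 < f x - c)%R by rewrite subr_gt0.
      rewrite -[ltRHS]invrK ltf_pV2 ?posrE ?invr_gt0//.
      have := archi_boundP (ltW (_ : 0 < (f x - c)^-1)%R).
      rewrite invr_gt0 => /(_ fc0) /lt_le_trans; apply.
      rewrite ler_nat (leq_trans (leq_addl m b))//.
      by rewrite -addn3 leq_addr.
    move=> ex; case: (ex_minnP ex) => i xi imin.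
    exists i.+1 => //; split => //=; rewrite xi/=.
    case: i xi imin => [|i] xi imin; first by rewrite addn0.
    by rewrite leNgt; apply/negP; rewrite addnS => /imin; rewrite ltnn.
  rewrite -lee_fin -hE//.
  apply: (le_trans (le_hausdorff s cover)).
  apply: (le_trans (hausdorff_sigma_subadditive s _)).
  apply: lime_le.
    by apply: is_cvg_nneseries => *; exact: hausdorff_ge0.
  apply: nearW => -[|n].
    rewrite big_geq// lee_fin.
    have hA0 : (0 <= h (A m))%R by rewrite fine_ge0// hausdorff_ge0.
    by have := AL m; lra.
  rewrite big_nat_recl//=.
  under eq_bigr do rewrite hE//.
  rewrite hE// sumEFin -EFinD lee_fin.
  have := hD m n; have := AL (m + n)%N.+1; have := AL (m + n)%N; lra.
rewrite !hE// -EFinD lee_fin.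
have : (L <= L + L - h (X `&` ~` F))%R; last by lra.
apply: ge_sup; first exact: supA.1.
by move=> _ [j _ <-]; have := hC j; lra.
Qed.

Lemma measurable_caratheodory_hausdorff s A :
  measurable A -> (hausdorff s).-caratheodory A.
Proof.
pose T := caratheodory_type (hausdorff s).
have mf (f : T -> R) :
    (forall x y : R * R, `|f x - f y| <= enorm (x - y))%R ->
    measurable_fun setT f.
  move=> f_lip; apply: (measurability _ (RGenOInfty.measurableE R)) => //.
  move=> _ [_ [c ->] <-]; rewrite setTI.
  rewrite (_ : _ @^-1` _ = ~` [set x | (f x <= c)%R]); last first.
    by apply/seteqP; split => x /=; rewrite in_itv/= andbT ltNge => /negP.
  apply: caratheodory_measurable_setC.
  exact: hausdorff_caratheodory_halfplane.
move: A; apply: smallest_sub; first exact: (@sigma_algebra_measurable _ T).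
move=> _ [[B mB <-]|[B mB <-]].
- apply: (mf fst) => // x y; rewrite (_ : _ - _ = (x - y).1)%R//.
  exact: ler_enorm1.
- apply: (mf snd) => // x y; rewrite (_ : _ - _ = (x - y).2)%R//.
  exact: ler_enorm2.
Qed.

End hausdorff.

(* By Caratheodory's theorem the restriction of a Hausdorff outer measure to
   any set [B], measurable or not, is a Borel measure; in particular
   [arclength] below needs no hypothesis on the function or the interval. *)
Section hausdorff_restr.
Context {R : realType}.
Local Open Scope ereal_scope.
Variables (s : R) (B : set (R * R)).

Definition hausdorff_restr (A : set (R * R)) : \bar R := hausdorff s (A `&` B).

Let hausdorff_restr0 : hausdorff_restr set0 = 0.
Proof. by rewrite /hausdorff_restr set0I hausdorff0. Qed.

Let hausdorff_restr_ge0 A : 0 <= hausdorff_restr A.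
Proof. exact: hausdorff_ge0. Qed.

Let hausdorff_restr_sigma_additive : semi_sigma_additive hausdorff_restr.
Proof.
move=> F mF tF mUF.
have cF k := measurable_caratheodory_hausdorff s (mF k).
rewrite /hausdorff_restr.
have -> : hausdorff s (\bigcup_n F n `&` B) =
    \sum_(k <oo) hausdorff s (F k `&` B).
  apply/eqP; rewrite eq_le; apply/andP; split.
    have := outer_measure_bigcup_lim (hausdorff s) F B.
    by rewrite setIC => /le_trans; apply; under eq_eseriesr do rewrite setIC.
  have := caratheodory_lime_le cF tF (B `&` \bigcup_n F n).
  rewrite -setIA setICr setI0 outer_measure0 adde0 setIC.
  apply: le_trans; apply: lee_nneseries => [k _ _|k _]; first exact: hausdorff_ge0.
  by apply: le_hausdorff => x [Fx Bx]; split => //; split => //; exists k.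
by apply: is_cvg_nneseries => k _ _; exact: hausdorff_ge0.
Qed.

HB.instance Definition _ := isMeasure.Build _ _ _ hausdorff_restr
  hausdorff_restr0 hausdorff_restr_ge0 hausdorff_restr_sigma_additive.

End hausdorff_restr.

Section fourier.
Context {R : realType}.
Implicit Types (nu : {measure set (R * R) -> \bar R}) (xi : R * R).

Definition expi (theta : R) : R[i] := (cos theta +i* sin theta)%C.

(* meaningful for bounded Borel [f] and finite [nu] *)
Definition cintegral nu (f : R * R -> R[i]) : R[i] :=
  ((\int[nu]_x complex.Re (f x)) +i* (\int[nu]_x complex.Im (f x)))%C.

Definition fourier nu xi : R[i] :=
  cintegral nu (fun x => expi (- (2 * pi * dotp x xi))).

(* |^nu(xi)| = O(|xi|^-alpha) as |xi| -> oo *)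
Definition fourier_decay (alpha : R) nu :=
  exists C : R, \forall xi \near enorm_infty,
    ComplexField.Normc.normc (fourier nu xi) <= C * (enorm xi) `^ (- alpha).

End fourier.

Section curves.
Context {R : realType}.

Definition strictly_convex_on (A : set R) (f : R -> R) :=
  forall x y t : R, A x -> A y -> x != y -> 0 < t < 1 ->
    f (t * x + (1 - t) * y) < t * f x + (1 - t) * f y.

Definition graph_over (f : R -> R) (A : set R) : set (R * R) :=
  [set (x, f x) | x in A].

Definition arclength (f : R -> R) (I : set R) :
    {measure set (R * R) -> \bar R} :=
  hausdorff_restr 1 (graph_over f I).

(* For compact [E] and [Gamma] the sum is compact, hence measurable.  The
   infimum is taken in [\bar R], so an empty set of admissible [t] would give
   [+oo]. *)
Definition sum_threshold (Gamma : set (R * R)) : \bar R :=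
  ereal_inf [set t%:E | t in [set t : R |
    forall E : set (R * R), compact E -> (t%:E < hausdorff_dim E)%E ->
      (0 < planar_lebesgue (minkowski_sum E Gamma))%E]].

End curves.

(* Main.v *)
Require Import Defs.
From HB Require Import structures.
From mathcomp Require Import all_boot all_order all_algebra.
From mathcomp Require Import all_classical all_reals all_analysis.
From mathcomp Require Import complex.
From mathcomp Require Import measurable_realfun zify ring lra.

Import Order.TTheory GRing.Theory Num.Theory.
Import numFieldNormedType.Exports.

Local Open Scope classical_set_scope.
Local Open Scope ring_scope.

(** The curve is the graph of a potential gamma(x) = int_[1,2] |x - s| dmu(s),
    so that gamma'' = 2 mu and every property of gamma is a property of the
    measure mu. Here mu is Lebesgue measure on a fat Cantor set, obtained from
    [1, 2] by removing a tiny interval around each dyadic point, plus a tiny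
    atom at each dyadic point.

    The atoms are dense, so gamma is strictly convex. The atom at the k-th
    dyadic point has mass 4^-k, and the points k < 2^(m+1) are spaced by at
    least 2^-m: to the right of a dyadic point q the measure of an interval of
    length 2^-m is, for m large, at most of order 2^-(2^m) ([curv_flat]), and
    on this interval the graph is, up to that error, a line segment
    ([gamma_chord]). If the Fourier transform of arclength on some arc were
    O(|xi|^-alpha), averaging it along the direction normal to such a segment
    against a Fejer kernel ([fejer_bound]) would bound the length of the
    segment by a positive power of the width of the strip containing it. As the
    width is smaller than any power of the length, this is impossible
    ([arclength_no_decay]).

    The threshold is at least 1 because of sets E that are Cantor sets of
    dimension s < 1 on a vertical line: every vertical section of E + Gamma is
    then empty or a translate of a Lebesgue null Cantor set
    ([small_set_null_sum]).

    It is at most 1 by a transversality argument. For x in R the map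
    e |-> e_2 + gamma(x - e_1) is a nonlinear projection whose values on E form
    the vertical section of E + Gamma at x. On the large set [core] of points
    that stay far, relatively to the size of the holes, from all the dyadic
    points, the holes are negligible at every scale: an interval [a, b] filling
    at least half of an interval with endpoints in [core] satisfies mu [a, b]
    >= (b - a) / 2 ([curv_core]). Hence the projections of two points e, e'
    separate at a speed comparable with |e_1 - e'_1| as x varies
    ([gamma_mixed]), and the r-neighborhoods of the two translated curves,
    restricted to [core], meet in area O(r^2 / |e - e'|)
    ([strip_transversality]). A set E with dim E > 1 carries, at each dyadic
    scale r, a finite atomic measure of mass bounded below that satisfies a
    Frostman condition of exponent s > 1 down to scale r ([finite_frostman]),
    so that its 1-energy truncated at scale r is bounded above
    ([energy_bound]). By the second moment method the r-neighborhood of E +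
    Gamma has area bounded below independently of r ([strip_union_ge]), and by
    compactness so does E + Gamma ([positive_sum]). *)

Set Implicit Arguments.
Unset Strict Implicit.
Unset Printing Implicit Defensive.

(** * Powers of one half *)

Section powers_of_half.
Context {R : realType}.

Lemma half_exp_gt0 n : 0 < 2^-1 ^+ n :> R.
Proof. by rewrite exprn_gt0// invr_gt0. Qed.

Lemma half_exp_ge0 n : 0 <= 2^-1 ^+ n :> R.
Proof. exact/ltW/half_exp_gt0. Qed.

Lemma half_exp_le1 n : 2^-1 ^+ n <= 1 :> R.
Proof. by rewrite exprn_ile1//; lra. Qed.

Lemma half_expn_lt (e : R) : 0 < e -> exists m, forall n, (m <= n)%N -> 2^-1 ^+ n < e.
Proof.
move=> e0.
have : (fun n => 2^-1 ^+ n : R) @ \oo --> 0.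
  by apply: cvg_expr; rewrite ger0_norm; lra.
move/cvgrPdist_lt => /(_ e e0)[m _ h]; exists m => n /h /=.
by rewrite sub0r normrN ger0_norm// exprn_ge0// invr_ge0.
Qed.

Lemma half_powR_lt (x : R) : 1 < x -> 2^-1 `^ x < 2^-1.
Proof.
move=> x1; rewrite -[ltRHS]powRr1 ?invr_ge0// /powR gt_eqF ?invr_gt0//.
have L : ln (2^-1 : R) < 0.
  by apply: ln_lt0; rewrite invr_gt0 ltr0n/= invf_lt1 ?ltr1n.
by rewrite ltr_expR ltr_nM2r.
Qed.

End powers_of_half.

(** * Dyadic points *)

Section dyadic_points.
Context {R : realType}.
Implicit Types (k m : nat) (c d : R).

(** The points k / 2^m with 2^m <= k < 2^(m+1) are the multiples of 2^-m in
    [1, 2), so every dyadic number of [1, 2) is listed, once for each of its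
    representations. [dyad 0 = 0] lies outside [1, 2]. *)
Definition dyad k : R := k%:R / (2 ^ trunc_log 2 k)%:R.

Lemma dyad_dense c d : 1 <= c -> c < d -> d <= 2 -> exists k, c < dyad k < d.
Proof.
move=> c1 cd d2.
have [m /(_ m (leqnn m)) hm] : exists m, forall n, (m <= n)%N -> 2^-1 ^+ n < d - c.
  by apply: half_expn_lt; rewrite subr_gt0.
have p0 : (0 : R) < 2 ^+ m by rewrite exprn_gt0.
have hm' : 1 < (d - c) * 2 ^+ m by rewrite -ltr_pdivrMr// div1r -exprVn.
have c0 : 0 <= c * 2 ^+ m by rewrite mulr_ge0 ?exprn_ge0//; lra.
have /andP[t1 t2] := truncn_itv c0.
set j := Num.truncn _ in t1 t2.
have j1 : j.+1%:R < d * 2 ^+ m by rewrite -natr1; nra.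
have L : trunc_log 2 j.+1 = m.
  apply: trunc_log_eq => //; apply/andP; split.
    by apply: ltnW; rewrite -(@ltr_nat R) natrX; nra.
  by rewrite -(@ltr_nat R) natrX exprS; nra.
exists j.+1; rewrite /dyad L natrX; apply/andP; split.
  by rewrite ltr_pdivlMr.
by rewrite ltr_pdivrMr.
Qed.

Lemma dyad_grid k m : (k < 2 ^ m.+1)%N ->
  exists a : nat, dyad k = a%:R * 2^-1 ^+ m.
Proof.
move=> km; exists (k * 2 ^ (m - trunc_log 2 k))%N.
have [->|k0] := posnP k; first by rewrite /dyad !mul0n !mul0r.
have tm : (trunc_log 2 k <= m)%N.
  by rewrite -ltnS -(@ltn_exp2l 2)// (leq_ltn_trans _ km)// trunc_logP.
rewrite /dyad natrM -mulrA; congr (_ * _).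
rewrite !natrX exprVn.
have -> : 2 ^+ m = 2 ^+ (m - trunc_log 2 k) * 2 ^+ trunc_log 2 k :> R.
  by rewrite -exprD subnK.
by rewrite invfM mulrA divff ?mul1r// expf_neq0.
Qed.

(** Both points are multiples of 2^-m. *)
Lemma dyad_gap i k m : (i < 2 ^ m.+1)%N -> (k < 2 ^ m.+1)%N ->
  dyad k <= dyad i \/ dyad i + 2^-1 ^+ m <= dyad k.
Proof.
move=> /dyad_grid[a ->] /dyad_grid[b ->].
have p0 : (0 : R) <= 2^-1 ^+ m by rewrite exprn_ge0// invr_ge0.
have [ba|ab] := leqP b a; [left|right].
  by rewrite ler_wpM2r// ler_nat.
rewrite -[X in _ + X]mul1r -mulrDl ler_wpM2r//.
by rewrite natr1 ler_nat.
Qed.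

End dyadic_points.

(** * Removing intervals around a sequence of points *)

Section fat_set.
Context {R : realType}.
Implicit Types (q r : nat -> R) (a b P : R).
Local Notation leb := (@lebesgue_measure R).

Definition holes q r : set R := \bigcup_k `]q k - r k, q k + r k[%classic.

Lemma measurable_holes q r : measurable (holes q r).
Proof. by apply: bigcup_measurable => k _. Qed.

Lemma lebesgue_holes q r P : (forall k, 0 <= r k <= P * 2^-1 ^+ k.+2) ->
  0 <= P -> (leb (holes q r) <= P%:E)%E.
Proof.
move=> hr P0.
apply: le_trans (epsilon_trick0 xpredT P0).
have mF k : measurable (`]q k - r k, q k + r k[%classic : set R) by exact: measurable_itv.
have mH := measurable_holes q r.
have := measure_sigma_subadditive leb mF mH.
move=> /(_ (@subset_refl _ _)) /le_trans; apply.
apply: lee_nneseries => // k _; rewrite /= lebesgue_measure_itv/=.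
have /andP[r0 rP] := hr k; case: ifPn => _; rewrite ?lee_fin; last first.
  by rewrite divr_ge0.
rewrite natrX -exprVn; move: rP; rewrite (exprS _ k.+1); set z := _ ^+ k.+1; lra.
Qed.

Lemma lebesgue_itv_minus_holes q r a b P : a <= b ->
  (forall k, 0 <= r k <= P * 2^-1 ^+ k.+2) -> 0 <= P ->
  ((b - a - P)%:E <= leb (`[a, b]%classic `\` holes q r))%E.
Proof.
move=> ab hr P0.
have mI : measurable (`[a, b]%classic : set R) by exact: measurable_itv.
have mH := measurable_holes q r.
rewrite EFinB leeBlDr//.
have -> : (b - a)%:E = leb `[a, b]%classic.
  rewrite lebesgue_measure_itv/= lte_fin; case: ltP => // ba.
  by rewrite (le_anti (_ : a <= b <= a))%R ?subrr// ab.
rewrite (@measureDI _ _ _ leb _ (holes q r))//.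
rewrite leeD2l// (le_trans _ (lebesgue_holes q hr P0))// le_measure// inE//.
exact: measurableI.
Qed.

End fat_set.

(** * The curvature measure *)

Section curvature_measure.
Context {R : realType}.
Local Notation leb := (@lebesgue_measure R).
Local Notation dyad := (@dyad R).

(** Half-widths of the intervals removed around the k-th dyadic point. The
    smaller ones define the set carrying the absolutely continuous part of the
    curvature; the larger ones define the set of points at which transversality
    holds. Their ratio 2^-(k+3) is summable, which makes the smaller holes
    negligible in any interval with endpoints outside the larger ones. *)
Definition core_gap (k : nat) : R := 2^-1 ^+ k.+3.
Definition fat_gap (k : nat) : R := core_gap k * 2^-1 ^+ k.+3.

Lemma core_gap_gt0 k : 0 < core_gap k. Proof. exact: half_exp_gt0. Qed.

Lemma fat_gap_gt0 k : 0 < fat_gap k.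
Proof. by rewrite mulr_gt0 ?half_exp_gt0. Qed.

Lemma fat_gap_le_core_gap k : fat_gap k <= core_gap k.
Proof. by rewrite ler_piMr ?half_exp_le1// ltW ?core_gap_gt0. Qed.

Definition fat : set R := `[1, 2]%classic `\` holes dyad fat_gap.
Definition core : set R := `[1, 2]%classic `\` holes dyad core_gap.

Lemma measurable_fat : measurable fat.
Proof. by apply: measurableD => //; exact: measurable_holes. Qed.

Lemma measurable_core : measurable core.
Proof. by apply: measurableD => //; exact: measurable_holes. Qed.

(** The k-th atom produces a kink of gamma. With mass 4^-k = 2^-k * 2^-k the
    tail of the masses from N on is at most 2 * 2^-N: one factor is bounded by
    2^-N and the other is summed. *)
Definition kink_weight (k : nat) : {nonneg R} :=
  NngNum (mulr_ge0 (half_exp_ge0 k) (half_exp_ge0 k)).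

Definition curv : {measure set (measurableTypeR R) -> \bar R} :=
  measure_add (mrestr leb measurable_fat)
    (mseries (fun k => mscale (kink_weight k) \d_(dyad k : measurableTypeR R)) 0).

Lemma curvE A : curv A =
  (leb (A `&` fat) + \sum_(k <oo) (2^-1 ^+ k * 2^-1 ^+ k)%:E * \d_(dyad k) A)%E.
Proof. exact: measure_addE. Qed.

Lemma kink_term_ge0 A k :
  (0 <= (2^-1 ^+ k * 2^-1 ^+ k : R)%:E * \d_(dyad k) A)%E.
Proof. by rewrite mule_ge0// lee_fin mulr_ge0// half_exp_ge0. Qed.

Lemma curv_finite : (curv setT < +oo)%E.
Proof.
rewrite curvE lte_add_pinfty//.
- rewrite setTI; apply: (@le_lt_trans _ _ (leb `[1, 2]%classic)); last first.
    by rewrite lebesgue_measure_itv/= lte_fin ltr1n -EFinB ltry.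
  apply: le_measure; rewrite ?inE//; first exact: measurable_fat.
  by move=> x [].
- apply: (@le_lt_trans _ _ 2%:E); last by rewrite ltry.
  apply: le_trans (epsilon_trick0 xpredT (_ : 0 <= 2)%R); last by [].
  apply: lee_nneseries => [k _ _|k _]; first exact: kink_term_ge0.
  rewrite diracT mule1 lee_fin natrX -exprVn exprS mulrA divff// mul1r.
  by rewrite ler_piMr ?half_exp_le1 ?half_exp_ge0.
Qed.

Lemma curv_itv_gt0 (c d : R) :
  1 <= c -> c < d -> d <= 2 -> (0 < curv `]c, d[%classic)%E.
Proof.
move=> c1 cd d2; have [k kcd] := dyad_dense c1 cd d2.
rewrite curvE; apply: (@lt_le_trans _ _ (2^-1 ^+ k * 2^-1 ^+ k)%:E).
  by rewrite lte_fin mulr_gt0// half_exp_gt0.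
rewrite (@nneseriesD1 _ _ k)//; last by move=> *; exact: kink_term_ge0.
rewrite diracE mem_set/=; last by rewrite in_itv.
rewrite mule1 addeCA leeDl// adde_ge0//.
by apply: nneseries_ge0 => *; exact: kink_term_ge0.
Qed.

(** The interval avoids the fat set, being inside the hole around [dyad i], and
    by [dyad_gap] contains only points [dyad k] with k >= 2^(m+1). *)
Lemma curv_flat i m : (i < 2 ^ m.+1)%N -> 2^-1 ^+ m <= fat_gap i ->
  (curv `]dyad i, (dyad i + 2^-1 ^+ m)%R[%classic <= (2 * 2^-1 ^+ (2 ^ m.+1) : R)%:E)%E.
Proof.
move=> im mi; set J := [set` _].
have JG : J `&` fat = set0.
  rewrite -subset0 => x []; rewrite {1}/J/= in_itv/= => /andP[x1 x2] [_]; apply.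
  exists i => //=; rewrite in_itv/=; apply/andP; split.
    by have := fat_gap_gt0 i; lra.
  by lra.
rewrite curvE JG measure0 add0e.
apply: le_trans (epsilon_trick0 xpredT (_ : 0 <= _)%R); last first.
  by rewrite mulr_ge0 ?half_exp_ge0.
apply: lee_nneseries => [k _ _|k _]; first exact: kink_term_ge0.
rewrite diracE; have [/set_mem|_] := boolP (dyad k \in J); last first.
  by rewrite mule0 lee_fin divr_ge0// mulr_ge0 ?half_exp_ge0.
rewrite /J/= in_itv/= mule1 lee_fin => /andP[k1 k2].
have mk : (2 ^ m.+1 <= k)%N.
  rewrite leqNgt; apply/negP => km.
  by have [|] := @dyad_gap R _ _ _ im km; lra.
rewrite natrX -exprVn (exprS _ k) [leRHS]mulrA ler_wpM2r// ?half_exp_ge0//.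
rewrite mulrAC divff// mul1r.
by apply: ler_wiXn2l => //; rewrite ?invr_ge0// invf_le1// ler1n.
Qed.

(** A hole of half-width [fat_gap k] meeting [a, b] has its center at distance
    at least [core_gap k] from v and w, hence 2 [core_gap k] <= w - v <=
    2 (b - a): the hole is a fraction 2^-(k+3) of [a, b], and all the holes
    together remove at most half of it. *)
Lemma curv_core v w a b : core v -> core w -> v <= a -> a <= b -> b <= w ->
  w - v <= 2 * (b - a) -> (((b - a) / 2)%:E <= curv `[a, b]%classic)%E.
Proof.
move=> cv cw va ab bw wv.
have [v1 hv] := cv; have [w1 hw] := cw.
have /andP[v12 _] : 1 <= v <= 2 by move: v1; rewrite /= in_itv.
have /andP[_ w2] : 1 <= w <= 2 by move: w1; rewrite /= in_itv.
rewrite curvE; apply: (@le_trans _ _ (leb (`[a, b]%classic `&` fat))); last first.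
  by rewrite leeDl// nneseries_ge0// => *; exact: kink_term_ge0.
(* only the holes meeting [a, b] matter *)
pose r k := if `[< exists2 s, a <= s <= b & dyad k - fat_gap k < s < dyad k + fat_gap k >]
  then fat_gap k else 0.
have r_ok k : 0 <= r k <= (b - a) / 2 * 2^-1 ^+ k.+2.
  rewrite /r; case: asboolP => [[s /andP[as_ sb] /andP[s1 s2]]|_]; last first.
    by rewrite lexx mulr_ge0 ?half_exp_ge0//; lra.
  rewrite (ltW (fat_gap_gt0 _))/=.
  have nv : ~ (dyad k - core_gap k < v < dyad k + core_gap k).
    by move=> h; apply: hv; exists k => //=; rewrite in_itv.
  have nw : ~ (dyad k - core_gap k < w < dyad k + core_gap k).
    by move=> h; apply: hw; exists k => //=; rewrite in_itv.
  have ee := fat_gap_le_core_gap k; have e0 := fat_gap_gt0 k.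
  have etab : core_gap k <= b - a.
    have hv2 : v <= dyad k - core_gap k.
      by rewrite leNgt; apply/negP => h; apply: nv; apply/andP; split => //; lra.
    have hw2 : dyad k + core_gap k <= w.
      by rewrite leNgt; apply/negP => h; apply: nw; apply/andP; split => //; lra.
    by lra.
  rewrite /fat_gap (exprS _ k.+2) mulrA ler_wpM2r// ?half_exp_ge0//.
  by rewrite ler_wpM2r//.
have h := @lebesgue_itv_minus_holes R dyad r a b _ ab r_ok.
apply: (@le_trans _ _ (leb (`[a, b]%classic `\` holes dyad r))).
  apply: le_trans (h _); last by lra.
  by rewrite lee_fin; lra.
apply: le_measure; rewrite ?inE.
- by apply: measurableD => //; exact: measurable_holes.
- by apply: measurableI => //; exact: measurable_fat.
move=> x [/=]; rewrite in_itv/= => /andP[ax xb] nx; split => //=.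
  exact/andP.
split => /=.
  by rewrite in_itv/=; apply/andP; split; lra.
move=> [k _ /=]; rewrite in_itv/= => kx; apply: nx; exists k => //=.
rewrite in_itv/= /r; case: asboolP => [_ //|[]].
by exists x => //; rewrite ax.
Qed.

Lemma lebesgue_core_shift (p : R) :
  ((2^-1 : R)%:E <= leb [set x : R | core (x - p)%R])%E.
Proof.
have -> : [set x | core (x - p)] =
    `[1 + p, 2 + p]%classic `\` holes (fun k => dyad k + p) core_gap.
  apply/seteqP; split => x /=; rewrite /core /= !in_itv/= => -[/andP[x1 x2] nx].
    split; first by apply/andP; split; lra.
    move=> [k _ /=]; rewrite in_itv/= => /andP[? ?]; apply: nx; exists k => //=.
    by rewrite in_itv/=; apply/andP; split; lra.
  split; first by apply/andP; split; lra.
  move=> [k _ /=]; rewrite in_itv/= => /andP[? ?]; apply: nx; exists k => //=.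
  by rewrite in_itv/=; apply/andP; split; lra.
have := @lebesgue_itv_minus_holes R (fun k => dyad k + p) core_gap (1 + p) (2 + p) 2^-1.
move=> /(_ _ _ _) H; apply: le_trans (H _ _ _); [rewrite lee_fin; lra|lra| |lra].
by move=> k; rewrite (ltW (core_gap_gt0 k))/= /core_gap (exprS _ k.+2).
Qed.

End curvature_measure.

(** * Potentials of finite measures on [1, 2] *)

Section potential.
Context {R : realType} (mu : {measure set (measurableTypeR R) -> \bar R}).
Context (mu_fin : (mu setT < +oo)%E).
Implicit Types x y s t : R.
Local Notation D := (`[1, 2]%classic : set R).

Definition potential x : R := \int[mu]_(s in D) `|x - s|.

Let mD : measurable (D : set (measurableTypeR R)).
Proof. exact: measurable_itv. Qed.

Lemma finite_sub (A : set (measurableTypeR R)) : measurable A -> (mu A < +oo)%E.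
Proof.
by move=> mA; apply: le_lt_trans mu_fin; apply: le_measure; rewrite ?inE.
Qed.

Lemma integrable_dist x : mu.-integrable D (EFin \o (fun s => `|x - s|)).
Proof.
apply: measurable_bounded_integrable => //; first exact: finite_sub.
  apply: measurableT_comp => //; exact: measurable_funB.
exists (`|x| + 2); split; first exact: num_real.
move=> M hM s; rewrite /= in_itv/= => /andP[s1 s2].
rewrite normr_id (le_trans (ler_normB _ _))// (le_trans _ (ltW hM))// lerD2l.
by rewrite ger0_norm; lra.
Qed.

Lemma Rintegral_ge_on (k : R -> R) (c : R) (A : set R) :
  mu.-integrable D (EFin \o k) -> (forall s, D s -> 0 <= k s) ->
  measurable (A : set (measurableTypeR R)) -> A `<=` D ->
  (forall s, A s -> c <= k s) ->
  c * fine (mu A) <= \int[mu]_(s in D) k s.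
Proof.
move=> ik k0 mA AD ck.
have fA : (mu A < +oo)%E by exact: finite_sub.
have iA : mu.-integrable (D `&` A) (EFin \o cst c).
  apply: measurable_bounded_integrable => //; first exact: measurableI.
    by apply: finite_sub; exact: measurableI.
  exact: bounded_cst.
rewrite -Rintegral_cst// -[in leLHS](setIidr AD) Rintegral_mkcondr.
apply: le_Rintegral => //.
  have -> : EFin \o (cst c \_ A) = (EFin \o cst c) \_ A.
    by apply/funext => s; rewrite /= /patch; case: ifP.
  exact/integrable_restrict.
move=> s Ds; rewrite patchE; case: ifPn => [/set_mem/ck //|_]; exact: k0.
Qed.

Lemma Rintegral_le_on (k : R -> R) (c : R) (A : set R) :
  mu.-integrable D (EFin \o k) -> 0 <= c ->
  measurable (A : set (measurableTypeR R)) ->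
  (forall s, A s -> k s <= c) -> (forall s, ~ A s -> k s <= 0) ->
  \int[mu]_(s in D) k s <= c * fine (mu A).
Proof.
move=> ik c0 mA ck nk.
have mDA := measurableI _ _ mD mA.
have iA : mu.-integrable (D `&` A) (EFin \o cst c).
  apply: measurable_bounded_integrable => //; first exact: finite_sub.
  exact: bounded_cst.
apply: (@le_trans _ _ (c * fine (mu (D `&` A)))); last first.
  rewrite ler_wpM2l// fine_le ?ge0_fin_numE ?finite_sub//.
  by apply: le_measure; rewrite ?inE// => x [].
rewrite -Rintegral_cst// Rintegral_mkcondr.
apply: le_Rintegral => //.
  have -> : EFin \o (cst c \_ A) = (EFin \o cst c) \_ A.
    by apply/funext => s; rewrite /= /patch; case: ifP.
  exact/integrable_restrict.
by move=> s Ds; rewrite patchE; case: ifPn => [/set_mem/ck //|/negP As];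
  apply: nk => /mem_set.
Qed.

Let iZ r x : mu.-integrable D (EFin \o (fun s => r * `|x - s|)).
Proof. by have := integrableZl mD r (integrable_dist x). Qed.

Lemma integrable_comb r x u y v z q w :
  mu.-integrable D (EFin \o (fun s =>
    r * `|x - s| + u * `|y - s| + (v * `|z - s| + q * `|w - s|))).
Proof.
have := integrableD mD (integrableD mD (iZ r x) (iZ u y))
  (integrableD mD (iZ v z) (iZ q w)).
by apply: eq_integrable.
Qed.

(** Four points cover both combinations that are needed: chords of the graph
    and mixed second differences. *)
Lemma potential_comb r x u y v z q w :
  r * potential x + u * potential y + (v * potential z + q * potential w) =
  \int[mu]_(s in D)
    (r * `|x - s| + u * `|y - s| + (v * `|z - s| + q * `|w - s|)).
Proof.
rewrite /potential -!RintegralZl//; [|exact: integrable_dist..].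
rewrite -!RintegralD ?iZ//.
- by have := integrableD mD (iZ r x) (iZ u y); apply: eq_integrable.
- by have := integrableD mD (iZ v z) (iZ q w); apply: eq_integrable.
Qed.

Lemma potential_lipschitz x y :
  `|potential x - potential y| <= fine (mu D) * `|x - y|.
Proof.
rewrite /potential -RintegralB//; [|exact: integrable_dist..].
have ixy : mu.-integrable D (EFin \o (fun s => `|x - s| - `|y - s|)).
  by have := integrableB mD (integrable_dist x) (integrable_dist y); apply: eq_integrable.
apply: (le_trans (le_normr_Rintegral mD ixy)).
rewrite mulrC -Rintegral_cst//; apply: le_Rintegral => //.
- by have := integrable_abse ixy; apply: eq_integrable.
- apply: measurable_bounded_integrable => //; first exact: finite_sub.
  exact: bounded_cst.
- move=> s _; apply: (le_trans (ler_dist_dist _ _)).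
  by rewrite opprB addrA subrK.
Qed.

End potential.

(** * Chords and mixed second differences of |x - s| *)

Section kernel.
Context {R : realType}.
Implicit Types x y s t : R.

Lemma chord_kernel_ge0 x y t s : 0 <= t <= 1 ->
  `|t * x + (1 - t) * y - s| <= t * `|x - s| + (1 - t) * `|y - s|.
Proof.
move=> /andP[t0 t1].
have -> : t * x + (1 - t) * y - s = t * (x - s) + (1 - t) * (y - s) by ring.
apply: (le_trans (ler_normD _ _)).
by rewrite !normrM (ger0_norm t0) (ger0_norm (_ : 0 <= 1 - t)) ?subr_ge0.
Qed.

Lemma chord_kernel_out x y t s : x <= y -> 0 <= t <= 1 -> ~ (x < s < y) ->
  t * `|x - s| + (1 - t) * `|y - s| = `|t * x + (1 - t) * y - s|.
Proof.
move=> xy /andP[t0 t1] nxy.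
have t1' : 0 <= 1 - t by lra.
have -> : t * x + (1 - t) * y - s = t * (x - s) + (1 - t) * (y - s) by ring.
have [sx|xs] := leP s x.
  have a : 0 <= x - s by lra.
  have b : 0 <= y - s by lra.
  by rewrite !ger0_norm// addr_ge0// mulr_ge0.
have [ys|sy] := leP y s; last by case: nxy; rewrite xs.
have a : x - s <= 0 by lra.
have b : y - s <= 0 by lra.
rewrite !ler0_norm//; first by ring.
by rewrite -oppr_ge0 opprD -!mulrN addr_ge0// mulr_ge0// oppr_ge0.
Qed.

Lemma chord_kernel_le x y t s : 0 <= t <= 1 -> x < s < y ->
  t * `|x - s| + (1 - t) * `|y - s| <= y - x.
Proof.
move=> /andP[t0 t1] /andP[xs sy].
rewrite ler0_norm ?subr_le0 ?(ltW xs)// ger0_norm ?subr_ge0 ?(ltW sy)//.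
nra.
Qed.

(** The kernel is a tent in s with top at z, of height 2 t (1 - t) (y - x) = 4
    e and slopes at most 2. *)
Lemma chord_kernel_gt x y t s (e := t * (1 - t) * (y - x) / 2)
    (z := t * x + (1 - t) * y) : x < y -> 0 < t < 1 -> z - e < s < z + e ->
  2 * e <= t * `|x - s| + (1 - t) * `|y - s| - `|z - s|.
Proof.
move=> xy /andP[t0 t1] /andP[s1 s2].
have h1 : `|z - s| <= e by rewrite ler_norml; apply/andP; split; lra.
have a1 : s - x <= `|x - s| by rewrite distrC ler_norm.
have a2 : y - s <= `|y - s| by rewrite ler_norm.
have b1 : t * (s - x) <= t * `|x - s| by rewrite ler_wpM2l// ltW.
have b2 : (1 - t) * (y - s) <= (1 - t) * `|y - s| by rewrite ler_wpM2l//; lra.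
have E : t * (s - x) + (1 - t) * (y - s) = 4 * e + (2 * t - 1) * (s - z).
  by rewrite /e /z; field.
have h2 : - e <= (2 * t - 1) * (s - z) by nra.
lra.
Qed.

Lemma mixed_kernel_ge0 v w tau s : 0 <= tau -> v + tau <= w ->
  `|v + tau - s| + `|w - tau - s| <= `|v - s| + `|w - s|.
Proof.
move=> t0 vw.
have [?|?] := ger0P (v - s); have [?|?] := ger0P (w - s);
have [?|?] := ger0P (v + tau - s); have [?|?] := ger0P (w - tau - s); lra.
Qed.

(** As a function of s the mixed difference is a trapezoid on [v, w] of slopes
    2, -2 and height 2 min(tau, w - v - tau); here p is at most half of the
    height. *)
Lemma mixed_kernel_ge v w tau p s : 0 <= tau -> v + tau <= w ->
  p <= tau -> p <= w - v - tau -> v + p / 2 <= s <= w - p / 2 ->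
  p <= `|v - s| + `|w - s| - `|v + tau - s| - `|w - tau - s|.
Proof.
move=> t0 vw pt ps /andP[s1 s2].
have [?|?] := ger0P (v - s); have [?|?] := ger0P (w - s);
have [?|?] := ger0P (v + tau - s); have [?|?] := ger0P (w - tau - s); lra.
Qed.

End kernel.

(** * The curve *)

Section gamma.
Context {R : realType}.
Implicit Types x y s t v w : R.
Local Notation curv := (@curv R).

Definition gamma : R -> R := potential curv.

(** The added 1 gives [1 <= lip], which makes the sup distance of two points
    comparable with their horizontal distance up to a factor [2 * lip] in
    [strip_meet_width]. *)
Definition lip : R := fine (curv `[1, 2]%classic) + 1.

Lemma lip_ge1 : 1 <= lip.
Proof. by rewrite /lip lerDr fine_ge0. Qed.

Lemma gamma_lipschitz x y : `|gamma x - gamma y| <= lip * `|x - y|.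
Proof.
apply: (le_trans (potential_lipschitz (curv_finite) x y)).
by rewrite ler_wpM2r// lerDl.
Qed.

(** The chord kernel vanishes off ]x, y[ and is at most y - x on it, so the
    deviation of the graph from its chords is controlled by the curvature
    strictly between the endpoints. *)
Lemma gamma_chord x y t : x <= y -> 0 <= t <= 1 ->
  0 <= t * gamma x + (1 - t) * gamma y - gamma (t * x + (1 - t) * y) <=
    (y - x) * fine (curv `]x, y[%classic).
Proof.
move=> xy t01.
have -> : t * gamma x + (1 - t) * gamma y - gamma (t * x + (1 - t) * y) =
   t * gamma x + (1 - t) * gamma y + ((- 1) * gamma (t * x + (1 - t) * y) + 0 * gamma x).
  by ring.
rewrite (potential_comb curv_finite); apply/andP; split.
  apply: Rintegral_ge0 => s _.
  by have := chord_kernel_ge0 x y s t01; lra.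
apply: Rintegral_le_on.
- exact: curv_finite.
- exact: integrable_comb curv_finite _ _ _ _ _ _ _ _.
- by rewrite subr_ge0.
- exact: measurable_itv.
- move=> s; rewrite /= in_itv/= => sxy.
  by have := chord_kernel_le t01 sxy; have := normr_ge0 (t * x + (1 - t) * y - s); lra.
- move=> s; rewrite /= in_itv/= => /(chord_kernel_out xy t01) => ->; lra.
Qed.

(** The chord kernel is bounded below on an interval around the intermediate
    point, and every interval has positive curvature. *)
Lemma gamma_strictly_convex : strictly_convex_on `[1, 2]%classic gamma.
Proof.
suff H x y t : 1 <= x -> y <= 2 -> x < y -> 0 < t < 1 ->
    gamma (t * x + (1 - t) * y) < t * gamma x + (1 - t) * gamma y.
  move=> x y t; rewrite /= !in_itv/= => /andP[x1 x2] /andP[y1 y2].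
  rewrite neq_lt => /orP[xy|yx] t01; first exact: H.
  rewrite addrC [ltRHS]addrC.
  have := H y x (1 - t) y1 x2 yx; rewrite subKr; apply.
  by apply/andP; split; lra.
move=> x1 y2 xy t01; have /andP[t0 t1] := t01.
rewrite -subr_gt0.
have -> : t * gamma x + (1 - t) * gamma y - gamma (t * x + (1 - t) * y) =
   t * gamma x + (1 - t) * gamma y + ((- 1) * gamma (t * x + (1 - t) * y) + 0 * gamma x).
  by ring.
rewrite (potential_comb curv_finite).
set e := t * (1 - t) * (y - x) / 2; set z := t * x + (1 - t) * y.
have p1 : 0 < t * (1 - t) by rewrite mulr_gt0//; lra.
have e0 : 0 < e by rewrite /e; rewrite divr_gt0// mulr_gt0//; lra.
have xe : x <= z - e.
  have : 0 <= (1 - t) * (y - x) * (1 - t / 2) by rewrite !mulr_ge0//; lra.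
  by rewrite /e /z; lra.
have ye : z + e <= y.
  have : 0 <= t * (y - x) * (1 - (1 - t) / 2) by rewrite !mulr_ge0//; lra.
  by rewrite /e /z; lra.
have cp : (0 < curv `](z - e)%R, (z + e)%R[%classic)%E by apply: curv_itv_gt0; lra.
apply: (@lt_le_trans _ _ (2 * e * fine (curv `](z - e), (z + e)[%classic))).
  rewrite mulr_gt0//; first lra.
  rewrite fine_gt0// cp/=; apply: finite_sub; first exact: curv_finite.
  exact: measurable_itv.
apply: Rintegral_ge_on.
- exact: curv_finite.
- exact: integrable_comb curv_finite _ _ _ _ _ _ _ _.
- move=> s _; have := @chord_kernel_ge0 R x y t s; rewrite (ltW t0) (ltW t1).
  by move=> /(_ erefl); rewrite -/z; lra.
- exact: measurable_itv.
- by move=> s; rewrite /= !in_itv/= => /andP[s1 s2]; apply/andP; split; lra.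
- move=> s; rewrite /= in_itv/= => sze.
  by have := chord_kernel_gt xy t01 sze; rewrite -/e -/z; lra.
Qed.

(** Strong convexity seen from [core]: only the two outer points v and w need
    to lie in it. The mixed kernel is at least p = min(tau, w - v - tau) on an
    interval of length max(tau, w - v - tau), and the curvature there is at
    least half of the length by [curv_core]. *)
Lemma gamma_mixed v w tau : core v -> core w -> 0 <= tau -> v + tau <= w ->
  tau * (w - v - tau) / 2 <=
    gamma v + gamma w - gamma (v + tau) - gamma (w - tau).
Proof.
move=> cv cw t0 vw; set p := Num.min tau (w - v - tau).
have pt : p <= tau by rewrite ge_min lexx.
have ps : p <= w - v - tau by rewrite ge_min lexx orbT.
have p0 : 0 <= p by rewrite le_min t0; lra.
have pE : p * (w - v - p) = tau * (w - v - tau).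
  by rewrite /p; case: leP => _; ring.
have -> : gamma v + gamma w - gamma (v + tau) - gamma (w - tau) =
  1 * gamma v + 1 * gamma w + ((- 1) * gamma (v + tau) + (- 1) * gamma (w - tau)).
  by ring.
rewrite (potential_comb curv_finite) -pE -mulrA.
have pw : w - v <= 2 * (w - p / 2 - (v + p / 2)).
  by rewrite /p; case: (leP tau (w - v - tau)) => ?; lra.
have va : v <= v + p / 2 by lra.
have ab : v + p / 2 <= w - p / 2 by lra.
have bw : w - p / 2 <= w by lra.
have := curv_core cv cw va ab bw pw.
set I := [set` _] => hI.
have mI : measurable (I : set (measurableTypeR R)) by exact: measurable_itv.
have [/= + _] := cv; rewrite in_itv/= => /andP[v1 _].
have [/= + _] := cw; rewrite in_itv/= => /andP[_ w2].
apply: (@le_trans _ _ (p * fine (curv I))).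
  rewrite ler_wpM2l//.
  have <- : w - p / 2 - (v + p / 2) = w - v - p by lra.
  rewrite -lee_fin fineK// ge0_fin_numE//.
  exact: finite_sub curv_finite _ mI.
apply: Rintegral_ge_on => //.
- exact: curv_finite.
- exact: integrable_comb curv_finite _ _ _ _ _ _ _ _.
- by move=> s _; have := mixed_kernel_ge0 s t0 vw; lra.
- by move=> s; rewrite /I/= !in_itv/= => /andP[s1 s2]; apply/andP; split; lra.
- move=> s; rewrite /I/= in_itv/= => sI.
  by have := mixed_kernel_ge t0 vw pt ps sI; lra.
Qed.

End gamma.

(** * Hausdorff measure and arclength *)

Section hausdorff_lemmas.
Context {R : realType}.
Implicit Types (A U : set (R * R)) (s c : R).
Local Notation leb := (@lebesgue_measure R).

Lemma enorm_ge0 (x : R * R) : 0 <= enorm x.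
Proof. exact: sqrtr_ge0. Qed.

Lemma ediam_ge0 U : U !=set0 -> (0 <= ediam U)%E.
Proof.
move=> [x Ux]; apply: le_trans (ediam_ub Ux Ux).
by rewrite lee_fin enorm_ge0.
Qed.

Lemma ediam_fin U (d : R) : U !=set0 -> (ediam U <= d%:E)%E ->
  exists2 e : R, ediam U = e%:E & 0 <= e.
Proof.
move=> U0 Ud; have h := ediam_ge0 U0.
have fU : ediam U \is a fin_num.
  by rewrite ge0_fin_numE// (le_lt_trans Ud) ?ltry.
by exists (fine (ediam U)); rewrite ?fineK// fine_ge0.
Qed.

(** A Hoelder map of exponent s sends a set of diameter d into an interval of
    length 2 c d^s. This gives both the lower bound of arclength by projection
    and, through the inverse of a parametrization, the positivity of the
    Hausdorff measures of Cantor sets. *)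
Lemma lebesgue_le_hausdorff (f : R * R -> R) A s c (S : set R) :
  0 < s -> 0 < c ->
  (forall x y, A x -> A y -> `|f x - f y| <= c * enorm (x - y) `^ s) ->
  measurable (S : set (measurableTypeR R)) -> S `<=` f @` A ->
  (leb S <= (2 * c)%:E * hausdorff s A)%E.
Proof.
move=> s0 c0 fA mS SA.
have c20 : 0 < 2 * c by rewrite mulr_gt0.
rewrite -lee_pdivrMl//.
apply: le_trans (hausdorff_pre_ub s A (ltr01)).
apply: le_ereal_inf_tmp => _ [U [AU dU] <-].
rewrite lee_pdivrMl// -nneseriesZl; last by move=> *; exact: diam_pow_ge0.
have hI k : exists I : set R, [/\ measurable (I : set (measurableTypeR R)),
    f @` (U k `&` A) `<=` I & (leb I <= (2 * c)%:E * diam_pow s (U k))%E].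
  have [[y [Uy Ay]]|e] := pselect (U k `&` A !=set0); last first.
    exists set0; split => //; first by move=> z [x xUA _]; case: e; exists x.
    by rewrite measure0 mule_ge0 ?lee_fin ?diam_pow_ge0// ltW.
  have Uk0 : U k !=set0 by exists y.
  have [e Ue e0] := ediam_fin Uk0 (dU k).
  exists `[f y - c * e `^ s, f y + c * e `^ s]%classic; split.
    exact: measurable_itv.
    move=> _ [x [Ux Ax] <-]; rewrite /= in_itv/= -ler_distl.
    apply: (le_trans (fA _ _ Ax Ay)); rewrite ler_wpM2l// ?(ltW c0)//.
    apply: ge0_ler_powR; rewrite ?nnegrE ?(ltW s0) ?enorm_ge0//.
    by rewrite -lee_fin -Ue; exact: ediam_ub.
  have /negbTE Un0 : U k != set0 by apply/set0P.
  rewrite lebesgue_measure_itv/= /diam_pow Un0.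
  rewrite Ue poweR_EFin -EFinM; case: ifPn => _.
    by rewrite -EFinB lee_fin; lra.
  by rewrite lee_fin mulr_ge0 ?powR_ge0// ltW.
have [I {}hI] := choice hI.
have mI k : measurable (I k : set (measurableTypeR R)) by have [] := hI k.
have SI : S `<=` \bigcup_k I k.
  move=> y /SA[x Ax <-]; have [k _ Ukx] := AU x Ax; exists k => //.
  by have [_ + _] := hI k; apply; exists x.
apply: (le_trans (measure_sigma_subadditive leb mI mS SI)).
by apply: lee_nneseries => // k _; by have [] := hI k.
Qed.

Lemma lebesgue_le_arclength (g : R -> R) (S : set R) :
  measurable (S : set (measurableTypeR R)) ->
  (leb S <= 2%:E * hausdorff 1 (graph_over g S))%E.
Proof.
move=> mS; rewrite -[X in X%:E](mulr1 2).
apply: (@lebesgue_le_hausdorff fst) => //.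
- move=> x y _ _; rewrite powRr1 ?enorm_ge0// mul1r.
  exact: (ler_enorm1 (x - y)).
- by move=> x Sx; exists (x, g x) => //; exists x.
Qed.

Lemma hausdorff_point (p : R * R) : hausdorff 1 [set p] = 0%E.
Proof.
apply/eqP; rewrite eq_le hausdorff_ge0 andbT.
apply: ge_ereal_sup => _ [d d0 <-].
have e0 : enorm (p - p) = 0.
  by rewrite subrr /enorm /dotp /= mulr0 addr0 sqrtr0.
have dp : ediam [set p] = 0%E.
  apply/eqP; rewrite eq_le ediam_ge0 ?andbT; last by exists p.
  by apply: ge_ereal_sup => _ [x ->] [y ->] <-; rewrite e0.
apply: ereal_inf_lbound; exists (fun k => if k is 0%N then [set p] else set0).
  split; first by move=> x ->; exists 0%N.
  by case=> [|k]; rewrite ?dp ?ediam0 ?leNye// lee_fin ltW.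
rewrite (@nneseriesD1 _ _ 0%N)//; last by move=> *; exact: diam_pow_ge0.
rewrite eseries0 ?adde0; last by move=> [|k] _ //= _; rewrite diam_pow0.
rewrite /diam_pow; case: ifP => // _.
by rewrite dp poweR_EFin powR0// oner_eq0.
Qed.

Lemma enorm_le (x : R * R) : enorm x <= `|x.1| + `|x.2|.
Proof.
rewrite -[leRHS]ger0_norm ?addr_ge0// -sqrtr_sqr /enorm ler_wsqrtr//.
rewrite /dotp -!expr2 -(real_normK (num_real x.1)) -(real_normK (num_real x.2)).
have : 0 <= `|x.1| * `|x.2| by rewrite mulr_ge0.
rewrite sqrrD; lra.
Qed.

Lemma ediam_le U (d : R) : (forall x y, U x -> U y -> enorm (x - y) <= d) ->
  (ediam U <= d%:E)%E.
Proof. by move=> h; apply: ge_ereal_sup => _ [x Ux] [y Uy] <-; rewrite lee_fin h. Qed.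

(** Cut [1, 2] into n intervals with (1 + L) / n <= d. *)
Lemma arclength_lipschitz_finite (g : R -> R) (L : R) :
  (forall x y, `|g x - g y| <= L * `|x - y|) ->
  (hausdorff 1 (graph_over g `[1%R, 2%R]%classic) < +oo)%E.
Proof.
move=> gL.
have L0 : 0 <= L.
  have := gL 1 0; rewrite subr0 normr1 mulr1; exact: le_trans.
apply: (@le_lt_trans _ _ (1 + L)%:E); last by rewrite ltry.
apply: ge_ereal_sup => _ [d /= d0 <-].
pose n := (Num.truncn ((1 + L) / d)).+1.
have nd : (1 + L) / n%:R <= d.
  rewrite ler_pdivrMr ?ltr0n// mulrC -ler_pdivrMr//.
  by rewrite ltW// truncnS_gt.
have n0 : (0 : R) < n%:R by rewrite ltr0n.
pose U k : set (R * R) := if (k < n)%N then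
  graph_over g `[1 + k%:R / n%:R, 1 + k.+1%:R / n%:R]%classic else set0.
have dU k : (ediam (U k) <= ((1 + L) / n%:R)%:E)%E.
  rewrite /U; case: ifPn => _; last by rewrite ediam0 leNye.
  apply: ediam_le => _ _ [x /= + <-] [y /= + <-]; rewrite !in_itv/=.
  rewrite -[k.+1%:R]natr1 mulrDl => /andP[x1 x2] /andP[y1 y2].
  apply: (le_trans (enorm_le _)) => /=.
  have xy : `|x - y| <= 1 / n%:R by rewrite ler_norml; apply/andP; split; lra.
  apply: (@le_trans _ _ (`|x - y| + L * `|x - y|)); first by rewrite lerD2l gL.
  rewrite -[X in X + _]mul1r -mulrDl -[n%:R^-1]mul1r.
  by rewrite ler_wpM2l// addr_ge0.
apply: (@le_trans _ _ (\sum_(k <oo) diam_pow 1 (U k))%E).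
  apply: ereal_inf_lbound; exists U => //; split; last first.
    by move=> k; apply: (le_trans (dU k)); rewrite lee_fin.
  move=> _ [x /= + <-]; rewrite in_itv/= => /andP[x1 x2].
  have [->|x2'] := eqVneq x 2.
    exists n.-1 => //; rewrite /U ltn_predL/=; exists 2 => //=.
    rewrite in_itv/= divff ?gt_eqF//; apply/andP; split; last by lra.
    suff : n.-1%:R / n%:R <= (1:R) by lra.
    by rewrite ler_pdivrMr// mul1r ler_nat leq_pred.
  have xn0 : 0 <= (x - 1) * n%:R by rewrite mulr_ge0// subr_ge0.
  have /andP[t1 t2] := truncn_itv xn0.
  set k := Num.truncn _ in t1 t2.
  have kn : (k < n)%N.
    rewrite -(@ltr_nat R) (le_lt_trans t1)// -[ltRHS]mul1r ltr_pM2r//.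
    by rewrite ltrBlDr lt_neqAle x2'.
  exists k => //; rewrite /U kn; exists x => //=; rewrite in_itv/=.
  apply/andP; split.
    by rewrite -lerBrDl ler_pdivrMr.
  by rewrite -lerBlDl ler_pdivlMr// ltW.
rewrite (nneseries_split 0%N n); last by move=> *; exact: diam_pow_ge0.
rewrite add0n [X in (_ + X)%E]eseries0 ?adde0; last first.
  by move=> k nk _; rewrite /U ltnNge nk/= diam_pow0.
apply: (@le_trans _ _ (\sum_(0 <= k < n) ((1 + L) / n%:R)%:E)%E).
  apply: lee_sum => k _; rewrite /diam_pow; case: ifPn => [_|/set0P U0].
    by rewrite lee_fin divr_ge0// addr_ge0.
  have [e Ue e0] := ediam_fin U0 (dU k).
  by rewrite Ue poweR_EFin powRr1// -Ue.
rewrite sumEFin lee_fin sumr_const_nat subn0 -[_ *+ n]mulr_natr.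
by rewrite divfK// gt_eqF.
Qed.

End hausdorff_lemmas.

(** * Fejer averages of Fourier transforms *)

Section fejer.
Context {R : realType} (nu : {measure set (R * R) -> \bar R}).
Context (nu_fin : (nu setT < +oo)%E).
Implicit Types (xi z : R * R).

Lemma integrable_bounded_fun (f : R * R -> R) (B : R) : measurable_fun setT f ->
  (forall z, `|f z| <= B) -> nu.-integrable setT (EFin \o f).
Proof.
move=> mf fB; apply: measurable_bounded_integrable => //.
exists B; split; first exact: num_real.
by move=> C BC z _ /=; rewrite (le_trans (fB z))// ltW.
Qed.

Lemma Rintegral_sum (n : nat) (f : nat -> R * R -> R) :
  (forall i, nu.-integrable setT (EFin \o f i)) ->
  \int[nu]_z (\sum_(i < n) f i z) = \sum_(i < n) \int[nu]_z f i z.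
Proof.
move=> fi; elim: n => [|n IH].
  rewrite big_ord0 (_ : (fun z => _) = cst 0); last first.
    by apply/funext => z; rewrite big_ord0.
  by rewrite Rintegral_cst// mul0r.
rewrite big_ord_recr/= -IH -RintegralD//.
  by apply: eq_Rintegral => z _; rewrite big_ord_recr.
have := integrable_sum measurableT [seq i <- index_enum 'I_n | true] (P := xpredT)
  (h := fun i : 'I_n => EFin \o f i) (fun i _ => fi i).
rewrite filter_predT; apply: eq_integrable => // z _.
by rewrite sumEFin.
Qed.

Lemma measurable_dotp xi : measurable_fun setT (dotp^~ xi : R * R -> R).
Proof.
by apply: measurable_funD; apply: measurable_funM.
Qed.

Lemma dotpZr (a : R) xi z : dotp z (a *: xi) = a * dotp z xi.
Proof.
rewrite /dotp; change (z.1 * (a * xi.1) + z.2 * (a * xi.2) = a * (z.1 * xi.1 + z.2 *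
  xi.2)).
by ring.
Qed.

Let phase (sigma : R) xi z : R := 2 * pi * (dotp z xi - sigma).

Let measurable_phase sigma xi (a : R) :
  measurable_fun setT (fun z => a * phase sigma xi z).
Proof.
apply: measurable_funM => //; apply: measurable_funM => //.
by apply: measurable_funB => //; exact: measurable_dotp.
Qed.

Lemma integrable_cos (f : R * R -> R) : measurable_fun setT f ->
  nu.-integrable setT (EFin \o (fun z => cos (f z))).
Proof.
move=> mf; apply: (@integrable_bounded_fun _ 1) => [|z]; last exact: cos_max.
apply: measurableT_comp => //; apply: continuous_measurable_fun.
exact: continuous_cos.
Qed.

Lemma integrable_sin (f : R * R -> R) : measurable_fun setT f ->
  nu.-integrable setT (EFin \o (fun z => sin (f z))).
Proof.
move=> mf; apply: (@integrable_bounded_fun _ 1) => [|z]; last exact: sin_max.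
apply: measurableT_comp => //; apply: continuous_measurable_fun.
exact: continuous_sin.
Qed.

Lemma cos_integral_le_fourier sigma xi (j : nat) (B : R) :
  ComplexField.Normc.normc (fourier nu (j%:R *: xi)) <= B ->
  `|\int[nu]_z cos (j%:R * phase sigma xi z)| <= 2 * B.
Proof.
set c := \int[nu]_z cos (2 * pi * dotp z (j%:R *: xi)).
set s := \int[nu]_z sin (2 * pi * dotp z (j%:R *: xi)).
have md : measurable_fun setT (fun z => 2 * pi * dotp z (j%:R *: xi)).
  by apply: measurable_funM => //; exact: measurable_dotp.
have -> : fourier nu (j%:R *: xi) = (c +i* - s)%C.
  rewrite /fourier /cintegral/=; congr (_ +i* _)%C.
    by apply: eq_Rintegral => z _; rewrite cosN.
  rewrite -mulN1r -RintegralZl//; last exact: integrable_sin.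
  by apply: eq_Rintegral => z _; rewrite sinN mulN1r.
rewrite /= sqrrN => cs.
have cB : `|c| <= B.
  by rewrite (le_trans _ cs)// -sqrtr_sqr ler_wsqrtr// lerDl sqr_ge0.
have sB : `|s| <= B.
  by rewrite (le_trans _ cs)// -sqrtr_sqr ler_wsqrtr// lerDr sqr_ge0.
set b := j%:R * (2 * pi * sigma).
have -> : \int[nu]_z cos (j%:R * phase sigma xi z) = cos b * c + sin b * s.
  rewrite -RintegralZl//; last exact: integrable_cos.
  rewrite -RintegralZl//; last exact: integrable_sin.
  rewrite -RintegralD//.
  - apply: eq_Rintegral => z _; rewrite [in RHS]mulrC [X in _ + X]mulrC -cosB.
    by congr cos; rewrite /phase /b dotpZr; ring.
  - by have := integrableZl measurableT (cos b) (integrable_cos md);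
      apply: eq_integrable.
  - by have := integrableZl measurableT (sin b) (integrable_sin md);
      apply: eq_integrable.
rewrite (le_trans (ler_normD _ _))// !normrM mulrDl mul1r lerD//.
- by rewrite (le_trans _ cB)// ler_piMl ?cos_max.
- by rewrite (le_trans _ sB)// ler_piMl ?sin_max.
Qed.

Lemma fejer_identity (N : nat) (t : R) :
  \sum_(n < N) \sum_(m < N) cos ((n%:R - m%:R) * t) =
  (\sum_(n < N) cos (n%:R * t)) ^+ 2 + (\sum_(n < N) sin (n%:R * t)) ^+ 2.
Proof.
rewrite !expr2 !big_distrlr/= -big_split/=; apply: eq_bigr => n _.
by rewrite -big_split/=; apply: eq_bigr => m _; rewrite mulrBl cosB.
Qed.

(** The mass near a line is bounded by the Fourier transform along the normal
    direction: the nonnegative kernel of [fejer_identity], evaluated at a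
    multiple of the signed distance to the line, is at least N^2 / 2 on A,
    while its integral has N diagonal terms equal to the total mass and at most
    N^2 other terms, each bounded by twice the modulus of the Fourier transform
    at a nonzero multiple of xi. *)
Lemma fejer_bound sigma xi (N : nat) (B h : R) (A : set (R * R)) : (0 < N)%N ->
  (forall j : nat, (0 < j)%N ->
     ComplexField.Normc.normc (fourier nu (j%:R *: xi)) <= B) ->
  measurable A -> (forall t, `|t| <= h -> 2^-1 <= cos t) ->
  (forall z, A z -> N%:R * (2 * pi * `|dotp z xi - sigma|) <= h) ->
  fine (nu A) / 2 <= fine (nu setT) / N%:R + 2 * B.
Proof.
move=> N0 FB mA ch Ah.
have B0 : 0 <= B by apply: le_trans (FB 1%N erefl); exact: sqrtr_ge0.
have N0' : 0 < N%:R :> R by rewrite ltr0n.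
pose F n m z := cos ((n%:R - m%:R) * phase sigma xi z).
have iF n m : nu.-integrable setT (EFin \o F n m).
  by apply: integrable_cos; exact: measurable_phase.
have iS n : nu.-integrable setT (EFin \o (fun z => \sum_(m < N) F n m z)).
  have := integrable_sum measurableT [seq i <- index_enum 'I_N | true] (P := xpredT)
    (h := fun i : 'I_N => EFin \o F n i) (fun i _ => iF n i).
  by rewrite filter_predT; apply: eq_integrable => // z _; rewrite sumEFin.
have iSS : nu.-integrable setT (EFin \o (fun z => \sum_(n < N) \sum_(m < N) F n m z)).
  have := integrable_sum measurableT [seq i <- index_enum 'I_N | true] (P := xpredT)
    (h := fun i : 'I_N => EFin \o (fun z => \sum_(m < N) F i m z)) (fun i _ => iS i).
  by rewrite filter_predT; apply: eq_integrable => // z _; rewrite sumEFin.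
have up : \int[nu]_z (\sum_(n < N) \sum_(m < N) F n m z) <=
    N%:R * fine (nu setT) + N%:R ^+ 2 * (2 * B).
  rewrite (Rintegral_sum N iS).
  under eq_bigr do rewrite (Rintegral_sum N (iF _)).
  apply: (@le_trans _ _ (\sum_(n < N) (fine (nu setT) + N%:R * (2 * B)))); last first.
    rewrite sumr_const card_ord -[_ *+ N]mulr_natl mulrDr.
    by rewrite expr2 -mulrA.
  apply: ler_sum => n _; rewrite (bigD1 n)//=; apply: lerD.
    rewrite /F subrr (_ : (fun z => _) = cst 1); last first.
      by apply/funext => z; rewrite mul0r cos0.
    by rewrite Rintegral_cst// mul1r.
  apply: (@le_trans _ _ (\sum_(m < N) (2 * B))); last first.
    by rewrite sumr_const card_ord -[_ *+ N]mulr_natl.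
  rewrite [leRHS](bigD1 n)//=.
  apply: (@le_trans _ _ (\sum_(m < N | m != n) (2 * B))); last first.
    by rewrite lerDr mulr_ge0.
  apply: ler_sum => m mn; apply: (le_trans (ler_norm _)).
  have [nm|nm] := leqP n m.
    have lt : (n < m)%N by rewrite ltn_neqAle eq_sym mn.
    rewrite (_ : \int[nu]_z F n m z =
      \int[nu]_z cos ((m - n)%:R * phase sigma xi z)); last first.
      by apply: eq_Rintegral => z _; rewrite /F natrB// -opprB mulNr cosN.
    by apply: cos_integral_le_fourier; apply: FB; rewrite subn_gt0.
  rewrite (_ : \int[nu]_z F n m z =
    \int[nu]_z cos ((n - m)%:R * phase sigma xi z)); last first.
    by apply: eq_Rintegral => z _; rewrite /F natrB// ltnW.
  by apply: cos_integral_le_fourier; apply: FB; rewrite subn_gt0.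
have low : N%:R ^+ 2 / 2 * fine (nu A) <=
    \int[nu]_z (\sum_(n < N) \sum_(m < N) F n m z).
  have iA : nu.-integrable (setT `&` A) (EFin \o cst (N%:R ^+ 2 / 2 : R)).
    rewrite setTI; apply: measurable_bounded_integrable => //.
      apply: le_lt_trans nu_fin.
      by apply: le_measure; rewrite ?inE.
    exact: bounded_cst.
  rewrite -Rintegral_cst// -[in leLHS](setTI A) Rintegral_mkcondr.
  apply: le_Rintegral => //.
    have -> : EFin \o (cst (N%:R ^+ 2 / 2 : R) \_ A) =
        (EFin \o cst (N%:R ^+ 2 / 2 : R)) \_ A.
      by apply/funext => z; rewrite /= /patch; case: ifP.
    exact/integrable_restrict.
  move=> z _; rewrite patchE; case: ifPn => [/set_mem Az|_]; last first.
    by rewrite fejer_identity addr_ge0// sqr_ge0.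
  apply: (@le_trans _ _ (\sum_(n < N) \sum_(m < N) (2^-1 : R))).
    rewrite !sumr_const card_ord -(mulr_natl (2^-1) N).
    by rewrite -(mulr_natl (N%:R * _) N) expr2; lra.
  apply: ler_sum => n _; apply: ler_sum => m _; apply: ch.
  apply: le_trans (Ah z Az).
  rewrite normrM /phase normrM (ger0_norm (_ : 0 <= 2 * pi)) ?mulr_ge0 ?pi_ge0//.
  apply: ler_wpM2r; first by rewrite mulr_ge0// mulr_ge0// pi_ge0.
  have n1 : n%:R <= N%:R :> R by rewrite ler_nat ltnW.
  have m1 : m%:R <= N%:R :> R by rewrite ler_nat ltnW.
  have n2 : 0 <= n%:R :> R by [].
  have m2 : 0 <= m%:R :> R by [].
  by rewrite ler_norml; apply/andP; split; lra.
have H := le_trans low up.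
have N20 : 0 < N%:R ^+ 2 :> R by rewrite exprn_gt0.
have E : N%:R ^+ 2 * (fine (nu setT) / N%:R + 2 * B) =
  N%:R * fine (nu setT) + N%:R ^+ 2 * (2 * B) by field; rewrite gt_eqF.
by rewrite -(ler_pM2l N20) E; apply: le_trans H; lra.
Qed.

End fejer.

(** * Absence of Fourier decay *)

Section no_decay.
Context {R : realType}.
Implicit Types (I : interval R) (alpha : R).
Local Notation leb := (@lebesgue_measure R).

Lemma cos_ge_half : exists2 h : R, 0 < h & forall t, `|t| <= h -> 2^-1 <= cos t.
Proof.
have /cvgrPdist_lt/(_ 2^-1) := @continuous_cos R 0.
rewrite invr_gt0 ltr0n => /(_ erefl) /nbhs_ballP[e /= e0 he].
exists (e / 2); first by rewrite divr_gt0.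
move=> t te; have : `|cos 0 - cos t| < 2^-1.
  by apply: he; rewrite /ball/= sub0r normrN; lra.
by rewrite cos0 => /ltr_normlW; lra.
Qed.

Lemma sqr_le_expn2 m : (4 <= m)%N -> (m * m <= 2 ^ m)%N.
Proof.
elim: m => // m IH; rewrite leq_eqVlt => /predU1P[<- //|m4].
have := IH m4; rewrite expnS => H.
apply: leq_trans (leq_mul (leqnn 2) H); rewrite mulSn mulnS.
nia.
Qed.

Lemma graph_overS (g : R -> R) (A B : set R) : A `<=` B ->
  graph_over g A `<=` graph_over g B.
Proof. by move=> AB _ [x Ax <-]; exists x => //; exact: AB. Qed.

Lemma arclength_finite I : [set` I] `<=` `[1, 2]%classic ->
  (arclength gamma [set` I] setT < +oo)%E.
Proof.
move=> I12; rewrite /arclength /= /hausdorff_restr setTI.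
apply: le_lt_trans (arclength_lipschitz_finite (@gamma_lipschitz R)).
by apply: le_hausdorff; exact: graph_overS.
Qed.

Lemma gamma_near_chord (q rho x : R) : 0 < rho -> q <= x <= q + rho ->
  `|gamma x - gamma q - (gamma (q + rho) - gamma q) / rho * (x - q)| <=
    rho * fine (curv `]q, q + rho[%classic).
Proof.
move=> r0 /andP[qx xq].
have u01 : 0 <= 1 - (x - q) / rho <= 1.
  rewrite subr_ge0 ler_pdivrMr// mul1r lerBlDl xq/= gerBl.
  by rewrite divr_ge0 ?subr_ge0// ltW.
have qr : q <= q + rho by lra.
have := gamma_chord qr u01.
have -> : (1 - (x - q) / rho) * q + (1 - (1 - (x - q) / rho)) * (q + rho) = x.
  by field; rewrite gt_eqF.
have -> : q + rho - q = rho by ring.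
move=> /andP[h1 h2]; rewrite -normrN ger0_norm.
  by apply: le_trans h2; rewrite le_eqVlt; apply/orP; left; apply/eqP; field;
    rewrite gt_eqF.
by apply: (le_trans h1); rewrite le_eqVlt; apply/orP; left; apply/eqP; field;
  rewrite gt_eqF.
Qed.

Lemma powR_decay (k m : nat) alpha (E : R) : 0 < alpha -> 2 <= k%:R * alpha ->
  2 ^+ (k * m) <= E -> E `^ (- alpha) <= (2^-1 ^+ m) ^+ 2.
Proof.
move=> a0 ka hE; rewrite powRN -exprM exprVn.
have p0 n : (0 : R) < 2 ^+ n by rewrite exprn_gt0.
have E0 : 0 < E by exact: lt_le_trans hE.
rewrite lef_pV2 ?posrE ?powR_gt0//.
apply: (@le_trans _ _ ((2 ^+ (k * m)) `^ alpha)); last first.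
  by apply: ge0_ler_powR => //; rewrite ?nnegrE; exact: ltW.
rewrite -!powR_mulrn// -powRrM; apply: ler_powR; first by rewrite ler1n.
by rewrite !natrM mulrAC [leLHS]mulrC ler_wpM2r.
Qed.

(** Take rho = 2^-m, the almost flat piece over [q, q + rho] next to a dyadic
    point q of the interval, N = rho^-2 terms in the Fejer kernel and
    frequencies of size tau = rho^-k with k alpha >= 2. Decay would give rho /
    4 <= (M + 2 C') rho^2, where M is the total mass. The kernel is large on
    the piece because its deviation from a line is below 2^-(2^m), while N tau
    is only a power of 2^m. *)
Theorem arclength_no_decay I c d alpha : [set` I] `<=` `[1, 2]%classic ->
  [set` I] c -> [set` I] d -> c < d -> 0 < alpha ->
  ~ fourier_decay alpha (arclength gamma [set` I]).
Proof.
move=> I12 Ic Id cd a0 [C [M0 _ /= hC]].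
set nu := arclength gamma [set` I] in hC *.
have nu_fin : (nu setT < +oo)%E by exact: arclength_finite.
have /andP[c1 _] : 1 <= c <= 2 by have := I12 c Ic; rewrite /= in_itv.
have /andP[_ d2] : 1 <= d <= 2 by have := I12 d Id; rewrite /= in_itv.
have [i /andP[cq qd]] := dyad_dense c1 cd d2.
set q : R := dyad i in cq qd.
have [h h0 ch] := cos_ge_half.
pose k := (Num.truncn (2 / alpha)).+1.
have ka : 2 <= k%:R * alpha by rewrite -ler_pdivrMr// ltW// truncnS_gt.
pose M := fine (nu setT).
have M_ge0 : 0 <= M by exact: fine_ge0.
pose C' := `|C| + 1.
(* smallness conditions on rho = 2^-m: the interval [q, q + rho] lies in the
   hole around q and in I, tau = 2^(k m) exceeds M0, the final inequality
   fails, and the phase on the flat piece is below h *)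
pose e1 := Num.min (Num.min (fat_gap i) (d - q))
  (Num.min (Num.min (`|M0| + 1)^-1 (4 * (M + 2 * C' + 1))^-1) (h / (4 * pi + 1))).
have pi0 : (0 : R) <= pi by exact: pi_ge0.
have C'0 : 0 < C' by rewrite /C' ltr_wpDl.
have K0 : 0 < 4 * (M + 2 * C' + 1) by lra.
have P0 : 0 < 4 * pi + 1 :> R by lra.
have e10 : 0 < e1.
  by rewrite !lt_min fat_gap_gt0 subr_gt0 qd !invr_gt0 ltr_wpDl//= K0 divr_gt0.
have [m1 hm1] := half_expn_lt e10.
pose m := maxn m1 (maxn i (maxn 4 k.+3)).
have m_i : (i <= m)%N by rewrite /m !leq_max leqnn ?orbT.
have m_4 : (4 <= m)%N by rewrite /m !leq_max leqnn ?orbT.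
have m_k : (k.+3 <= m)%N by rewrite /m !leq_max leqnn ?orbT.
have m_1 : (m1 <= m)%N by rewrite /m !leq_max leqnn ?orbT.
have := hm1 m m_1; rewrite !lt_min.
set rho : R := 2^-1 ^+ m.
have rho0 : 0 < rho by exact: half_exp_gt0.
move=> /and3P[/andP[r_eps r_d] /andP[r_M r_K] r_h].
have im : (i < 2 ^ m.+1)%N.
  by rewrite (leq_ltn_trans m_i)// (leq_trans (ltn_expl _ (isT : (1 < 2)%N)))// leq_exp2l.
pose J : set R := `[q, q + rho]%classic.
have JI : J `<=` [set` I].
  move=> x; rewrite /J/= in_itv/= => /andP[x1 x2].
  by apply: (interval_is_interval (i := I) Ic Id); apply/andP; split; lra.
pose sl := (gamma (q + rho) - gamma q) / rho.
pose tau : R := 2 ^+ (k * m).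
have tau0 : 0 < tau by rewrite exprn_gt0.
pose xi : R * R := (tau * - sl, tau).
pose sigma := tau * (gamma q - sl * q).
pose N := (2 ^ (2 * m))%N.
have N0 : (0 < N)%N by rewrite expn_gt0.
have NE : N%:R * rho ^+ 2 = 1 :> R.
  by rewrite /N /rho natrX -exprM mulnC exprVn divff// expf_neq0.
pose A := [set z : R * R | N%:R * (2 * pi * `|dotp z xi - sigma|) <= h].
have mA : measurable A.
  have : measurable_fun setT (fun z : R * R => N%:R * (2 * pi * `|dotp z xi - sigma|)).
    apply: measurable_funM => //; apply: measurable_funM => //.
    apply: measurableT_comp => //; apply: measurable_funB => //.
    exact: measurable_dotp.
  move=> /(_ measurableT `]-oo, h]%classic (measurable_itv _)).
  rewrite setTI; congr measurable; apply/seteqP; split => z /=; by rewrite in_itv.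
have JA : graph_over gamma J `<=` A.
  move=> _ [x + <-]; rewrite /J/= in_itv/= => xJ.
  have := gamma_near_chord rho0 xJ; rewrite -/sl => near; rewrite /A /=.
  have -> : dotp (x, gamma x) xi - sigma =
      tau * (gamma x - gamma q - sl * (x - q)).
    by rewrite /dotp /sigma /=; ring.
  have flat : fine (curv `]q, q + rho[%classic) <= 2 * 2^-1 ^+ (2 ^ m.+1).
    rewrite -lee_fin fineK; first exact: (curv_flat im (ltW r_eps)).
    rewrite ge0_fin_numE//; apply: finite_sub; first exact: curv_finite.
    exact: measurable_itv.
  rewrite normrM (gtr0_norm tau0).
  have {}near := le_trans near (ler_wpM2l (ltW rho0) flat).
  apply: (@le_trans _ _ (N%:R * (2 * pi * (tau * (rho * (2 * 2^-1 ^+ (2 ^ m.+1))))))).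
    by rewrite ler_wpM2l// ler_wpM2l ?mulr_ge0// ler_wpM2l// ltW.
  (* 2^((k + 3) m) <= 2^(2^m) as m >= k + 3 and m^2 <= 2^m *)
  have small : N%:R * tau * 2^-1 ^+ (2 ^ m.+1) <= rho.
    rewrite /rho /N /tau natrX -exprD.
    rewrite !exprVn ler_pdivrMr ?exprn_gt0// ler_pdivlMl ?exprn_gt0// -exprD.
    rewrite ler_weXn2l ?ler1n//.
    have := leq_trans (leq_mul m_k (leqnn m)) (sqr_le_expn2 m_4).
    rewrite expnS mul2n -addnn => H; apply: leq_trans (leq_addr _ _).
    by apply: leq_trans H; rewrite !mulSn !addnA.
  have rho1 : rho <= 1 by exact: half_exp_le1.
  have -> : N%:R * (2 * pi * (tau * (rho * (2 * 2^-1 ^+ (2 ^ m.+1))))) =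
    4 * pi * rho * (N%:R * tau * 2^-1 ^+ (2 ^ m.+1)) by ring.
  apply: (@le_trans _ _ (4 * pi * rho * rho)).
    by rewrite ler_wpM2l// !mulr_ge0// ltW.
  move: r_h; rewrite ltr_pdivlMr// => r_h.
  have : 4 * pi * rho * rho <= 4 * pi * rho * 1.
    by rewrite ler_wpM2l// !mulr_ge0// ltW.
  by lra.
have FB j : (0 < j)%N ->
    ComplexField.Normc.normc (fourier nu (j%:R *: xi)) <= C' * rho ^+ 2.
  move=> j0.
  have tauE : tau <= enorm (j%:R *: xi).
    apply: le_trans (ler_enorm2 _).
    change (tau <= `|j%:R * tau|); rewrite normrM (gtr0_norm tau0).
    by rewrite ger0_norm// ler_peMl ?ler1n// ltW.
  have M0E : M0 < enorm (j%:R *: xi).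
    apply: lt_le_trans tauE; apply: (le_lt_trans (ler_norm _)).
    apply: (@lt_le_trans _ _ (2 ^+ m)); last first.
      by rewrite /tau ler_weXn2l ?ler1n// leq_pmull.
    have M01 : 0 < `|M0| + 1 by rewrite ltr_wpDl.
    have p2 : (0 : R) < 2 ^+ m by rewrite exprn_gt0.
    have : `|M0| + 1 < 2 ^+ m by rewrite -ltf_pV2 ?posrE// -exprVn.
    by apply: lt_trans; rewrite ltrDl.
  apply: (le_trans (hC _ M0E)).
  apply: (@le_trans _ _ (C' * enorm (j%:R *: xi) `^ (- alpha))).
    by rewrite ler_wpM2r ?powR_ge0// /C' (le_trans (ler_norm C))// lerDl.
  by rewrite ler_wpM2l ?(ltW C'0)// (powR_decay a0 ka).
have := fejer_bound nu_fin N0 FB mA ch (fun z (Az : A z) => Az).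
have -> : fine (nu setT) / N%:R = M * rho ^+ 2.
  have Nn0 : N%:R != 0 :> R by rewrite pnatr_eq0 -lt0n.
  by apply: (mulfI Nn0); rewrite [RHS]mulrCA NE mulr1 mulrC divfK.
have low : rho / 2 <= fine (nu A).
  have mJ : measurable (J : set (measurableTypeR R)) by exact: measurable_itv.
  have nuA : nu A \is a fin_num.
    rewrite ge0_fin_numE// (le_lt_trans _ nu_fin)//.
    by apply: le_measure; rewrite ?inE.
  have H : (hausdorff 1 (graph_over gamma J) <= nu A)%E.
    apply: le_hausdorff => z Jz; split; first exact: JA.
    exact: graph_overS Jz.
  have := le_trans (lebesgue_le_arclength gamma mJ) (lee_wpmul2l _ H).
  rewrite lebesgue_measure_itv/= lte_fin ltrDl rho0 -EFinB -(fineK nuA) -EFinM.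
  rewrite lee_fin => /(_ (ler0n _ 2)); rewrite lee_fin; lra.
move: r_K; rewrite -div1r ltr_pdivlMr// => r_K lowB.
have : rho <= rho * (rho * (4 * (M + 2 * C' + 1))).
  by have := sqr_ge0 rho; rewrite expr2 in lowB *; lra.
rewrite -{1}[rho]mulr1 ler_pM2l//; lra.
Qed.

Lemma limf_esup_decay alpha (nu : {measure set (R * R) -> \bar R}) :
  ~ fourier_decay alpha nu ->
  limf_esup (fun xi : R * R =>
    (enorm xi `^ alpha * ComplexField.Normc.normc (fourier nu xi))%:E)
    enorm_infty = +oo%E.
Proof.
move=> nd; apply/eqP; rewrite -leye_eq limf_esupE.
apply: le_ereal_inf_tmp => _ [V [M0 _ MV] <-].
rewrite leye_eq; apply/eqP; apply: contrapT => /eqP supV.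
apply: nd.
have V0 : V (`|M0| + 1, 0).
  apply: MV => /=; apply: (lt_le_trans _ (ler_enorm1 _)) => /=.
  rewrite ger0_norm ?addr_ge0// (le_lt_trans (ler_norm _))// ltrDl//.
set S := ereal_sup _ in supV.
have S0 : (0 <= S)%E.
  apply: (@le_trans _ _ (enorm (`|M0| + 1, 0) `^ alpha *
    ComplexField.Normc.normc (fourier nu (`|M0| + 1, 0)))%:E).
    by rewrite lee_fin mulr_ge0 ?powR_ge0//; exact: sqrtr_ge0.
  by apply: ereal_sup_ubound; exists (`|M0| + 1, 0).
have Sfin : S \is a fin_num by rewrite ge0_fin_numE// ltey.
exists (fine S); exists (Num.max M0 0) => // xi /=; rewrite gt_max => /andP[Mx x0].
have : ((enorm xi `^ alpha * ComplexField.Normc.normc (fourier nu xi))%:E <= S)%E.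
  by apply: ereal_sup_ubound; exists xi => //; exact: MV.
rewrite -[S]fineK// lee_fin mulrC -ler_pdivlMr ?powR_gt0//.
by rewrite powRN.
Qed.

Lemma interval_two_points I : (exists x y, [/\ [set` I] x, [set` I] y & x < y]) \/
  (exists x, [set` I] `<=` [set x]).
Proof.
have [[x [y [Ix Iy xy]]]|no] := pselect (exists x y, [/\ [set` I] x, [set` I] y & x < y]).
  by left; exists x, y.
right; have [[x Ix]|e] := pselect (exists x, [set` I] x); last first.
  by exists 0 => x Ix; case: e; exists x.
exists x => y Iy; apply: contrapT => /eqP; rewrite neq_lt => /orP[|] xy; apply: no.
  by exists y, x.
by exists x, y.
Qed.

End no_decay.

(** * Cantor sets *)

Section cantor.
Context {R : realType} (theta : R).
Context (theta0 : 0 < theta) (theta1 : theta < 1).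
Implicit Types (u v : R) (n m : nat).
Local Notation leb := (@lebesgue_measure R).

(** The parametrization by theta, with 2 [ratio] = theta^2, turns the terms (2
    [ratio])^m into a product theta^m * theta^m: for m >= n one factor is
    bounded by theta^n and the other is summed. *)
Definition ratio : R := theta ^+ 2 / 2.

Let ratio0 : 0 < ratio.
Proof. by rewrite divr_gt0// exprn_gt0. Qed.

Let cell n u : R := (Num.floor (2 ^+ n * u))%:~R.

Let cell_le n u : cell n u <= 2 ^+ n * u.
Proof. exact: floor_le. Qed.

Let cell_gt n u : 2 ^+ n * u < cell n u + 1.
Proof. by have := floorD1_gt (2 ^+ n * u); rewrite intrD. Qed.

Let cell_homo n u v : u <= v -> cell n u <= cell n v.
Proof. by move=> uv; rewrite ler_int le_floor// ler_wpM2l// exprn_ge0. Qed.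

(** [spread] is a strictly increasing pure jump function, the inverse of a
    Cantor function: it jumps by at least [ratio ^+ n] at each multiple of
    2^-n, and the closure of its range is a Cantor set of ratio [ratio].
    Writing it with the number of multiples of 2^-m in ]0, u], rather than with
    the binary digits of u, makes all the increments nonnegative. *)
Definition spread_term u : R^nat := fun m => ratio ^+ m * cell m u.

Definition spread u : R := limn (series (spread_term u)).

Let ratio_split m : ratio ^+ m * 2 ^+ m = theta ^+ m * theta ^+ m.
Proof. by rewrite -exprMn /ratio mulfVK// exprMn. Qed.

Let cvg_geometric_theta (a : R) : cvgn (series (geometric a theta)).
Proof. by apply: is_cvg_geometric_series; rewrite gtr0_norm. Qed.

Lemma cvg_spread u : 0 <= u <= 1 -> cvgn (series (spread_term u)).
Proof.
move=> /andP[u0 u1]; apply: (@series_le_cvg _ _ (geometric 1 theta)) => [m|m|m|];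
  last exact: cvg_geometric_theta.
- by rewrite mulr_ge0 ?exprn_ge0 ?(ltW ratio0)// ler0z floor_ge0 mulr_ge0 ?exprn_ge0.
- by rewrite /geometric/= mul1r exprn_ge0// ltW.
- rewrite /geometric/= mul1r.
  apply: (@le_trans _ _ (ratio ^+ m * 2 ^+ m)).
    rewrite ler_wpM2l ?exprn_ge0 ?(ltW ratio0)//.
    by rewrite (le_trans (cell_le m u))// ler_piMr// exprn_ge0.
  by rewrite ratio_split ler_piMl ?exprn_ge0 ?exprn_ile1 ?ltW.
Qed.

Let spreadB u v : 0 <= u <= 1 -> 0 <= v <= 1 ->
  cvgn (series (spread_term v - spread_term u)) /\
  spread v - spread u = limn (series (spread_term v - spread_term u)).
Proof.
move=> u01 v01; split; first by apply: is_cvg_seriesB; exact: cvg_spread.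
by rewrite lim_seriesB//; exact: cvg_spread.
Qed.

Lemma spread_ge u v n : 0 <= u -> u <= v -> v <= 1 -> 2^-1 ^+ n <= v - u ->
  ratio ^+ n <= spread v - spread u.
Proof.
move=> u0 uv v1 nuv.
have u01 : 0 <= u <= 1 by rewrite u0 (le_trans uv).
have v01 : 0 <= v <= 1 by rewrite v1 (le_trans u0).
have [cvB ->] := spreadB u01 v01.
set d := _ - _ in cvB *.
have dE m : d m = ratio ^+ m * (cell m v - cell m u) by rewrite mulrBr.
have d0 m : 0 <= d m.
  by rewrite dE mulr_ge0 ?exprn_ge0 ?(ltW ratio0)// subr_ge0 cell_homo.
have nd : nondecreasing_seq (series d) by exact: nondecreasing_series.
apply: le_trans (nondecreasing_cvgn_le nd cvB n.+1).
rewrite seriesSr; apply: (@le_trans _ _ (d n)); last first.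
  by rewrite lerDr; apply: sumr_ge0.
rewrite dE ler_peMr ?exprn_ge0 ?(ltW ratio0)//.
rewrite -intrB ler1z -gtz0_ge1 subr_gt0 -(@ltr_int R) -/(cell n u) -/(cell n v).
have p0 : (0 : R) < 2 ^+ n by rewrite exprn_gt0.
move: nuv; rewrite exprVn -div1r ler_pdivrMr// => nuv.
rewrite -(ltrD2r 1); apply: le_lt_trans (cell_gt n v).
have := cell_le n u; lra.
Qed.

(** On a dyadic interval of level n only the terms of index m > n vary, and the
    m-th one by at most [ratio ^+ m] * 2^(m - n). *)
Lemma spread_cell u v n : 0 <= u -> u <= v -> v <= 1 ->
  cell n u = 2 ^+ n * u -> 2 ^+ n * v < cell n u + 1 ->
  0 <= spread v - spread u <= 2^-1 ^+ n * theta ^+ n / (1 - theta).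
Proof.
move=> u0 uv v1 cu cv.
have u01 : 0 <= u <= 1 by rewrite u0 (le_trans uv).
have v01 : 0 <= v <= 1 by rewrite v1 (le_trans u0).
have [cvB ->] := spreadB u01 v01.
set d := _ - _ in cvB *.
have dE m : d m = ratio ^+ m * (cell m v - cell m u) by rewrite mulrBr.
have d0 m : 0 <= d m.
  by rewrite dE mulr_ge0 ?exprn_ge0 ?(ltW ratio0)// subr_ge0 cell_homo.
apply/andP; split.
  have nd : nondecreasing_seq (series d) by exact: nondecreasing_series.
  apply: le_trans (nondecreasing_cvgn_le nd cvB 0%N).
  by rewrite /series /= big_geq.
have gl : limn (series (geometric (2^-1 ^+ n * theta ^+ n) theta)) =
    2^-1 ^+ n * theta ^+ n / (1 - theta).
  by apply/cvg_lim => //; apply: cvg_geometric_series; rewrite gtr0_norm.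
rewrite -gl.
apply: lim_series_le => // m; rewrite dE /geometric/=.
have p0 k : (0 : R) < 2 ^+ k by rewrite exprn_gt0.
have nm_le : (m <= n)%N -> cell m v = cell m u.
  move=> mn; apply/eqP; rewrite eq_le (cell_homo m uv) andbT ler_int -ltzD1.
  rewrite floor_lt_int intrD -/(cell m u).
  have nE : 2 ^+ n = 2 ^+ (n - m) * 2 ^+ m :> R by rewrite -exprD subnK.
  (* u = j / 2^n with j an integer, and v < (j + 1) / 2^n *)
  have := cell_gt m u; rewrite -(ltr_pM2l (p0 (n - m)%N)) mulrA -nE -cu.
  have -> : 2 ^+ (n - m) * (cell m u + 1) =
      ((2 ^+ (n - m) : int) * (Num.floor (2 ^+ m * u) + 1))%:~R :> R.
    by rewrite intrM intrD -/(cell m u); congr (_ * _); rewrite rmorphXn.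
  rewrite ltr_int -lezD1 => h.
  rewrite -(ltr_pM2l (p0 (n - m)%N)) mulrA -nE.
  apply: (lt_le_trans cv).
  have -> : 2 ^+ (n - m) * (cell m u + 1) =
      ((2 ^+ (n - m) : int) * (Num.floor (2 ^+ m * u) + 1))%:~R :> R.
    by rewrite intrM intrD -/(cell m u); congr (_ * _); rewrite rmorphXn.
  by rewrite -[1]/(1%:~R) -intrD ler_int.
have [mn|nm] := leqP m n.
  rewrite nm_le// subrr mulr0 mulr_ge0// ?exprn_ge0 ?(ltW theta0)//.
  by rewrite mulr_ge0// exprn_ge0// ?invr_ge0// ltW.
have nE : 2 ^+ m = 2 ^+ (m - n) * 2 ^+ n :> R by rewrite -exprD subnK// ltnW.
have cdiff : cell m v - cell m u <= 2 ^+ (m - n).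
  have h1 : cell m v <= 2 ^+ m * v by [].
  have h2 : 2 ^+ (m - n) * (2 ^+ n * u) <= cell m u.
    rewrite -cu.
    have -> : 2 ^+ (m - n) * cell n u =
        ((2 ^+ (m - n) : int) * Num.floor (2 ^+ n * u))%:~R :> R.
      by rewrite intrM; congr (_ * _); rewrite rmorphXn.
    rewrite ler_int floor_ge_int intrM -/(cell n u) cu mulrA nE.
    by rewrite rmorphXn.
  have h3 : 2 ^+ (m - n) * (2 ^+ n * v) <= 2 ^+ (m - n) * (2 ^+ n * u + 1).
    by rewrite ler_wpM2l ?exprn_ge0// -cu ltW.
  rewrite nE -mulrA in h1; lra.
apply: (@le_trans _ _ (ratio ^+ m * 2 ^+ (m - n))).
  by rewrite ler_wpM2l// exprn_ge0// ltW.
have -> : 2 ^+ (m - n) = 2^-1 ^+ n * 2 ^+ m :> R.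
  by rewrite nE mulrCA exprVn mulVf ?mulr1// gt_eqF.
rewrite mulrCA ratio_split -mulrA ler_wpM2l ?half_exp_ge0//.
rewrite ler_wpM2r ?exprn_ge0 ?(ltW theta0)//.
by rewrite ler_wiXn2l ?(ltW theta0) ?(ltW theta1)// ltnW.
Qed.

Definition cantor_set : set R := closure (spread @` `[0, 1[%classic).

Definition cantor_piece n (j : nat) : set R :=
  `[spread (j%:R * 2^-1 ^+ n),
    spread (j%:R * 2^-1 ^+ n) + 2^-1 ^+ n * theta ^+ n / (1 - theta)]%classic.

Definition cantor_cover n : set R :=
  \big[setU/set0]_(j < (2 ^ n)%N) cantor_piece n j.

Lemma cantor_set_cover n : cantor_set `<=` cantor_cover n.
Proof.
have clK : closed (cantor_cover n).
  by apply: closed_bigsetU => j _; exact: itv_closed.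
move/closure_id : clK => ->; apply: closureS => _ [u /= + <-].
rewrite in_itv/= => /andP[u0 u1].
have p0 : (0 : R) < 2 ^+ n by rewrite exprn_gt0.
have pu0 : 0 <= 2 ^+ n * u by rewrite mulr_ge0// ltW.
have /andP[t1 t2] := truncn_itv pu0.
set j := Num.truncn _ in t1 t2.
have jn : (j < 2 ^ n)%N.
  by rewrite -(@ltr_nat R) (le_lt_trans t1)// natrX -[ltRHS]mulr1 ltr_pM2l.
rewrite /cantor_cover -bigcup_mkord; exists j => //=; rewrite /cantor_piece/= in_itv/=.
pose u0' := j%:R * 2^-1 ^+ n : R.
have u0E : 2 ^+ n * u0' = j%:R.
  by rewrite /u0' exprVn mulrCA divff ?mulr1// gt_eqF.
have u0'u : u0' <= u by rewrite -(ler_pM2l p0) u0E.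
have cE : cell n u0' = j%:R by rewrite /cell u0E floorK// -[j%:R]/(j%:~R) intrKfloor.
have hu : 2 ^+ n * u < j%:R + 1 by rewrite natr1.
have := @spread_cell u0' u n; rewrite cE u0E => H.
have /andP[] := H (mulr_ge0 (ler0n _ _) (half_exp_ge0 _)) u0'u (ltW u1) erefl hu.
by rewrite subr_ge0 lerBlDl => -> ->.
Qed.

Lemma cantor_set_compact : compact cantor_set.
Proof.
apply: (@subclosed_compact _ _ (cantor_cover 0)).
- exact: closed_closure.
- by rewrite /cantor_cover expn0 big_ord_recl big_ord0 setU0; exact: segment_compact.
- exact: cantor_set_cover.
Qed.

Lemma cantor_shift_null (a : R) : leb [set y | cantor_set (y - a)] = 0%E.
Proof.
set S := [set y | _].
have mC : measurable (cantor_set : set (measurableTypeR R)).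
  by apply: closed_measurable; exact: closed_closure.
have mS : measurable (S : set (measurableTypeR R)).
  have : measurable_fun setT (fun y : R => y - a) by exact: measurable_funB.
  by move=> /(_ measurableT _ mC); rewrite setTI.
apply/eqP; rewrite eq_le measure_ge0 andbT.
have bound n : (leb S <= (theta ^+ n / (1 - theta))%:E)%E.
  pose l : R := 2^-1 ^+ n * theta ^+ n / (1 - theta).
  pose F j : set R := `[spread (j%:R * 2^-1 ^+ n) + a,
    spread (j%:R * 2^-1 ^+ n) + l + a]%classic.
  have l0 : 0 <= l.
    by rewrite divr_ge0 ?mulr_ge0 ?exprn_ge0 ?subr_ge0 ?invr_ge0// ltW.
  have mF j : measurable (F j : set (measurableTypeR R)) by exact: measurable_itv.
  apply: (@le_trans _ _ (leb (\big[setU/set0]_(j < (2 ^ n)%N) F j))).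
    apply: le_measure; rewrite ?inE//; first exact: bigsetU_measurable.
    move=> y /cantor_set_cover-/(_ n); rewrite /cantor_cover -!bigcup_mkord.
    move=> [j /= jn]; rewrite /cantor_piece/= in_itv/= => /andP[j1 j2]; exists j => //.
    by rewrite /F/= in_itv/= /l; apply/andP; split; lra.
  apply: (le_trans (Boole_inequality leb _)) => //.
  apply: (@le_trans _ _ (\sum_(j < (2 ^ n)%N) l%:E)%E).
    apply: lee_sum => j _; rewrite /= lebesgue_measure_itv/=.
    by case: ifPn => _; rewrite -?EFinB lee_fin; lra.
  rewrite sumEFin lee_fin sumr_const card_ord -[_ *+ _]mulr_natl natrX /l exprVn.
  by rewrite !mulrA divff ?mul1r// expf_neq0.
apply/lee_addgt0Pr => e e0; rewrite add0e.
have e1 : 0 < e * (1 - theta) by rewrite mulr_gt0// subr_gt0.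
have : (fun n => theta ^+ n) @ \oo --> 0 by apply: cvg_expr; rewrite gtr0_norm.
move/cvgrPdist_lt => /(_ _ e1)[n _ /(_ n (leqnn n))] /=.
rewrite sub0r normrN gtr0_norm ?exprn_gt0// => h.
apply: (le_trans (bound n)).
by rewrite lee_fin ler_pdivrMr ?subr_gt0// ltW.
Qed.

(** The inverse of [spread] is Hoelder of exponent s by [spread_ge], and maps
    onto [0, 1[. *)
Lemma cantor_hausdorff_gt0 (s : R) : 0 < s -> ratio `^ s = 2^-1 ->
  (0 < hausdorff s [set ((0%R : R), y) | y in cantor_set])%E.
Proof.
move=> s0 rs.
have sep u v : 0 <= u -> u <= v -> v < 1 -> v - u <= 2 * `|spread v - spread u| `^ s.
  move=> u0 uv v1.
  have [->|uv'] := eqVneq u v; first by rewrite subrr mulr_ge0// powR_ge0.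
  have duv : 0 < v - u by rewrite subr_gt0 lt_neqAle uv'.
  have [n0 hn0] := half_expn_lt duv.
  have ex : exists n, 2^-1 ^+ n <= v - u by exists n0; rewrite ltW// hn0.
  case: (ex_minnP ex) => n nuv nmin.
  have nn : v - u <= 2 * 2^-1 ^+ n.
    case: n nuv nmin => [|n] nuv nmin; first by rewrite expr0 mulr1; lra.
    rewrite exprS mulrA divff// mul1r leNgt; apply/negP => /ltW/nmin.
    by rewrite ltnn.
  apply: (le_trans nn); rewrite ler_wpM2l//.
  have sge := spread_ge u0 uv (ltW v1) nuv.
  rewrite -rs -powR_mulrn ?powR_ge0// -powRrM mulrC powRrM powR_mulrn ?(ltW ratio0)//.
  apply: ge0_ler_powR; rewrite ?nnegrE ?(ltW s0)//.
    by rewrite exprn_ge0// ltW.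
  exact: le_trans sge (ler_norm _).
have sep' u v : 0 <= u < 1 -> 0 <= v < 1 ->
    `|u - v| <= 2 * `|spread u - spread v| `^ s.
  move=> /andP[u0 u1] /andP[v0 v1]; have [uv|vu] := leP u v.
    by rewrite distrC [in leRHS]distrC ger0_norm ?subr_ge0//; exact: sep.
  by rewrite ger0_norm ?subr_ge0 ?(ltW vu)//; apply: sep => //; exact: ltW.
have inj u v : 0 <= u < 1 -> 0 <= v < 1 -> spread u = spread v -> u = v.
  move=> u01 v01 uv; have := sep' u v u01 v01.
  rewrite uv subrr normr0 powR0 ?gt_eqF// mulr0 normr_le0 subr_eq0.
  by move/eqP.
pose f (z : R * R) : R := xget 0 [set u | 0 <= u < 1 /\ spread u = z.2].
have fE u : 0 <= u < 1 -> f (0, spread u) = u.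
  move=> u01; rewrite /f; case: xgetP => [v _ [v01 uv]|/(_ u)]; last by case.
  exact: inj.
pose A := [set (0 : R, spread u) | u in `[0, 1[%classic].
have : (leb `[0%R, 1%R[%classic <= (2 * 2 : R)%:E * hausdorff s A)%E.
  apply: (@lebesgue_le_hausdorff R f) => //.
  - move=> _ _ [u /= + <-] [v /= + <-]; rewrite !in_itv/= => u01 v01.
    rewrite !fE//; apply: (le_trans (sep' u v u01 v01)); rewrite ler_wpM2l//.
    apply: ge0_ler_powR; rewrite ?nnegrE ?(ltW s0)//; first exact: enorm_ge0.
    exact: (ler_enorm2 ((0 : R, spread u) - (0, spread v))).
  - move=> u u01; exists (0, spread u); first by exists u.
    by rewrite fE//; move: u01; rewrite /= in_itv.
rewrite lebesgue_measure_itv/= lte_fin ltr01 oppr0 adde0 => h.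
have : (0 < hausdorff s A)%E.
  rewrite lt_neqAle hausdorff_ge0 andbT; apply/negP => /eqP h0.
  by move: h; rewrite -h0 mule0 lee_fin ler10.
move/lt_le_trans; apply; apply: le_hausdorff => _ [u u01 <-].
by exists (spread u) => //; apply: subset_closure; exists u.
Qed.

End cantor.

(** * Sets of dimension close to one with a null sum *)

Section lower_bound.
Context {R : realType}.
Local Notation leb := (@lebesgue_measure R).

Lemma le_diam_pow (r s : R) (U : set (R * R)) : 0 <= r -> r <= s -> 0 < s ->
  (ediam U <= 1%:E)%E -> (diam_pow s U <= diam_pow r U)%E.
Proof.
move=> r0 rs s0 U1; rewrite /diam_pow; case: ifPn => // /set0P U0.
have [e Ue e0] := ediam_fin U0 U1.
rewrite Ue !poweR_EFin lee_fin; move: U1; rewrite Ue lee_fin => e1.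
have [->|en0] := eqVneq e 0; first by rewrite powR0 ?gt_eqF// powR_ge0.
by apply: ger_powR => //; rewrite lt_neqAle eq_sym en0 e0.
Qed.

Lemma le_hausdorff_exponent (r s : R) (A : set (R * R)) :
  0 <= r -> r <= s -> 0 < s -> (hausdorff s A <= hausdorff r A)%E.
Proof.
move=> r0 rs s0; apply: ge_ereal_sup => _ [d /= d0 <-].
pose d1 := Num.min d 1.
have d10 : 0 < d1 by rewrite lt_min d0 ltr01.
apply: (@le_trans _ _ (hausdorff_pre s d1 A)).
  by apply: hausdorff_pre_le; rewrite ge_min lexx.
apply: le_trans (hausdorff_pre_ub r A d10).
apply: le_ereal_inf_tmp => _ [U [AU dU] <-].
apply: (@le_trans _ _ (\sum_(k <oo) diam_pow s (U k))%E).
  by apply: ereal_inf_lbound; exists U.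
apply: lee_nneseries => [k _ _|k _]; first exact: diam_pow_ge0.
apply: le_diam_pow => //; apply: (le_trans (dU k)).
by rewrite lee_fin ge_min lexx orbT.
Qed.

Lemma hausdorff_dim_ge (s : R) (A : set (R * R)) : 0 < s ->
  (0 < hausdorff s A)%E -> (s%:E <= hausdorff_dim A)%E.
Proof.
move=> s0 sA; apply: le_ereal_inf_tmp => _ [r [r0 rA] <-].
rewrite lee_fin leNgt; apply/negP => rs; move: sA.
by rewrite ltNge -rA le_hausdorff_exponent// ltW.
Qed.

Lemma xsection_vertical_sum (C : set R) (f : R -> R) (x : R) :
  xsection (minkowski_sum [set (0 : R, y) | y in C] (graph_over f `[1, 2])) x =
  if x \in `[1, 2] then [set y | C (y - f x)] else set0.
Proof.
apply/seteqP; split => [y /xsectionP/= [_ [c Cc <-]] [_ [u u12 <-]]|y].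
  move=> [<- <-]; rewrite add0r u12/=.
  by rewrite (_ : c + f u - f u = c)// addrK.
case: ifPn => // x12 /= Cy; apply/xsectionP => /=.
exists (0, y - f x); first by exists (y - f x).
exists (x, f x); first by exists x.
by congr pair; rewrite /= ?add0r// subrK.
Qed.

(** The set is vertical, so that the sections of the sum are translates of the
    Cantor set whatever the function f; its contraction ratio b = 2^(-1/s)
    gives dimension at least s, and 2 b < 1 makes it Lebesgue null. *)
Theorem small_set_null_sum (t : R) : t < 1 ->
  exists E : set (R * R), [/\ compact E, (t%:E < hausdorff_dim E)%E &
    forall f, planar_lebesgue (minkowski_sum E (graph_over f `[1, 2])) = 0%E].
Proof.
move=> t1.
pose s := (Num.max t 0 + 1) / 2.
have m1 : Num.max t 0 < 1 by rewrite gt_max t1 ltr01.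
have m0 : 0 <= Num.max t 0 by rewrite le_max lexx orbT.
have ts : t < s.
  have : t <= Num.max t 0 by rewrite le_max lexx.
  by rewrite /s; lra.
have s0 : 0 < s by rewrite /s; lra.
have s1 : s < 1 by rewrite /s; lra.
pose b : R := 2^-1 `^ s^-1.
have b0 : 0 < b by rewrite powR_gt0// invr_gt0.
have b2 : 2 * b < 1.
  by have := half_powR_lt (_ : 1 < s^-1); rewrite invf_gt1// -/b => /(_ s1); lra.
pose theta := Num.sqrt (2 * b).
have th0 : 0 < theta by rewrite sqrtr_gt0 mulr_gt0.
have th1 : theta < 1 by rewrite -sqrtr1 ltr_sqrt.
have rs : ratio theta `^ s = 2^-1.
  rewrite /ratio sqr_sqrtr ?mulr_ge0 ?(ltW b0)// mulrAC divff// mul1r /b -powRrM.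
  by rewrite mulVf ?gt_eqF// powRr1// invr_ge0.
exists [set (0 : R, y) | y in cantor_set theta]; split.
- have cf : continuous (fun y : R => (0 : R, y)).
    by move=> y; apply: (@cvg_pair _ _ _ _ (nbhs (0 : R)) (nbhs y));
      [exact: cvg_cst|exact: cvg_id].
  apply: continuous_compact (cantor_set_compact th0 th1).
  exact: continuous_subspaceT.
- apply: lt_le_trans (hausdorff_dim_ge s0 (cantor_hausdorff_gt0 th0 th1 s0 rs)).
  by rewrite lte_fin.
- move=> f; rewrite /planar_lebesgue /product_measure1.
  apply: integral0_eq => x _ /=; rewrite xsection_vertical_sum.
  case: ifPn => _; last by rewrite measure0.
  exact: cantor_shift_null.
Qed.

End lower_bound.

(** * Finite Frostman measures *)

Section frostman.
Context {R : realType}.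
Implicit Types (E : set (R * R)) (p : R * R) (k d : nat) (c : int * int).

Definition cell k p : int * int :=
  (Num.floor (2 ^+ k * p.1), Num.floor (2 ^+ k * p.2)).

Definition children c : seq (int * int) :=
  [:: (2 * c.1, 2 * c.2); (2 * c.1 + 1, 2 * c.2);
      (2 * c.1, 2 * c.2 + 1); (2 * c.1 + 1, 2 * c.2 + 1)].

Lemma children_uniq c : uniq (children c).
Proof. by rewrite /= !inE /= !xpair_eqE; lia. Qed.

Lemma children_inj c1 c2 c : c \in children c1 -> c \in children c2 -> c1 = c2.
Proof.
case: c1 c2 c => [i1 j1] [i2 j2] [i j]; rewrite !inE /= !xpair_eqE => h1 h2.
by congr pair; lia.
Qed.

Lemma floor_double (y : R) :
  Num.floor (2 * y) = 2 * Num.floor y \/ Num.floor (2 * y) = 2 * Num.floor y + 1.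
Proof.
have /andP[h1 h2] := floor_itv y.
have /andP[h3 h4] := floor_itv (2 * y).
have : 2 * Num.floor y <= Num.floor (2 * y).
  by rewrite floor_ge_int intrM; lra.
have : Num.floor (2 * y) < 2 * Num.floor y + 2.
  by rewrite floor_lt_int intrD intrM; move: h2; rewrite intrD; lra.
lia.
Qed.

Lemma cell_children k p : cell k.+1 p \in children (cell k p).
Proof.
rewrite /cell exprS -!mulrA !inE /=.
have [->|->] := floor_double (2 ^+ k * p.1);
by have [->|->] := floor_double (2 ^+ k * p.2); rewrite !eqxx ?orbT.
Qed.

Lemma floor_divn (y : R) (n : nat) : (0 < n)%N ->
  Num.floor (y / n%:R) = Num.floor ((Num.floor y)%:~R / n%:R : R).
Proof.
move=> n0; have n0' : (0 : R) < n%:R by rewrite ltr0n.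
apply/eqP; rewrite eq_le !floor_ge_int; apply/andP; split.
  rewrite ler_pdivlMr// -[n%:R]/(n%:~R) -intrM ler_int floor_ge_int intrM.
  by rewrite -ler_pdivlMr// floor_le.
apply: (le_trans (floor_le _)); rewrite ler_pM2r ?invr_gt0//; exact: floor_le.
Qed.

(** Cells of level k' >= k determine the cell of level k containing them
    ([cell_ancestor]), so that a cell receives mass from only one child of any
    larger one. *)
Definition ancestor k k' c : int * int :=
  (Num.floor (c.1%:~R / (2 ^ (k' - k))%:R : R),
   Num.floor (c.2%:~R / (2 ^ (k' - k))%:R : R)).

Lemma cell_ancestor k k' p : (k <= k')%N -> cell k p = ancestor k k' (cell k' p).
Proof.
move=> kk; rewrite /ancestor /cell/= -!floor_divn ?expn_gt0//.
have E2 : 2 ^+ k' = 2 ^+ k * 2 ^+ (k' - k) :> R by rewrite -exprD subnKC.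
have n0 : 2 ^+ (k' - k) != 0 :> R by rewrite expf_neq0.
by rewrite natrX E2; congr pair; congr Num.floor; field.
Qed.

(** Finite atomic measures are represented by lists of weighted points. *)
Definition mass (L : seq (R * (R * R))) (P : pred (R * R)) : R :=
  \sum_(x <- L | P x.2) x.1.

Lemma mass_cat L1 L2 P : mass (L1 ++ L2) P = mass L1 P + mass L2 P.
Proof. by rewrite /mass big_cat. Qed.

Lemma mass_flatten (I : Type) (s : seq I) (L : I -> seq (R * (R * R))) P :
  mass (flatten [seq L i | i <- s]) P = \sum_(i <- s) mass (L i) P.
Proof.
elim: s => [|i s IH]; first by rewrite /= /mass !big_nil.
by rewrite /= mass_cat IH big_cons.
Qed.

Definition nonneg_on E (L : seq (R * (R * R))) :=
  forall x, x \in L -> 0 <= x.1 /\ E x.2.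

Lemma mass_le E L P : nonneg_on E L -> mass L P <= mass L xpredT.
Proof.
move=> L0; rewrite /mass big_mkcond [leRHS]big_seq big_seq; apply: ler_sum => x /L0[x0 _].
by case: ifP.
Qed.

Section recursion.
Context (b : R) (b0 : 0 < b) (E : set (R * R)).

(** Capacity, from the cell c of level k down to depth d, of the tree of dyadic
    cells meeting E when each cell of level k' has capacity [b ^+ k']. It plays
    the role of the max flow, equal to the min cut. *)
Fixpoint flow d k c : R :=
  if d is d'.+1 then Num.min (b ^+ k) (\sum_(c' <- children c) flow d' k.+1 c')
  else if `[< exists2 p, E p & cell k p = c >] then b ^+ k else 0.

Lemma flow_ge0 d k c : 0 <= flow d k c.
Proof.
elim: d k c => [|d IH] k c /=.
  by case: ifP => // _; rewrite exprn_ge0// ltW.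
by rewrite le_min exprn_ge0 ?(ltW b0)//= sumr_ge0.
Qed.

(** Max flow: a load within the capacity of a cell is split among its children
    in proportion to their capacities. *)
Lemma flow_measure d k c t : 0 <= t <= flow d k c ->
  exists L, [/\ nonneg_on (fun p => E p /\ cell k p = c) L, mass L xpredT = t &
    forall k' c', (k <= k' <= k + d)%N ->
      mass L (fun p => cell k' p == c') <= b ^+ k'].
Proof.
elim: d k c t => [|d IH] k c t /=.
  case: ifPn => [/asboolP[p Ep pc]|_] /andP[t0 t1].
    have Lt : nonneg_on (fun p => E p /\ cell k p = c) [:: (t, p)].
      by move=> x; rewrite inE => /eqP ->.
    have Lm : mass [:: (t, p)] xpredT = t by rewrite /mass big_seq1.
    exists [:: (t, p)]; split => // k' c'; rewrite addn0 -eqn_leq => /eqP <-.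
    by rewrite (le_trans (mass_le _ Lt))// Lm.
  exists [::]; split => //; first by rewrite /mass big_nil; lra.
  by move=> k' c' _; rewrite /mass big_nil exprn_ge0// ltW.
rewrite le_min => /and3P[t0 tb tS].
set S := \sum_(c' <- children c) _ in tS.
pose tt c' := t * (flow d k.+1 c' / S).
have S0 : 0 <= S by apply: sumr_ge0 => *; exact: flow_ge0.
have tt0 c' : 0 <= tt c' <= flow d k.+1 c'.
  rewrite /tt mulr_ge0 ?divr_ge0 ?flow_ge0//=.
  have [SE|Sn0] := eqVneq S 0; first by rewrite SE invr0 !mulr0 flow_ge0.
  rewrite mulrA ler_pdivrMr ?lt_neqAle 1?eq_sym ?Sn0// mulrC.
  by rewrite ler_wpM2l// flow_ge0.
have ttS : \sum_(c' <- children c) tt c' = t.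
  rewrite /tt -mulr_sumr -mulr_suml -/S.
  have [SE|Sn0] := eqVneq S 0; last by rewrite divff// mulr1.
  by rewrite SE mul0r mulr0; move: tS; rewrite SE; lra.
have [LL hL] := choice (fun c' => IH k.+1 c' _ (tt0 c')).
pose L := flatten [seq LL c' | c' <- children c].
have child_parent c' p : c' \in children c -> cell k.+1 p = c' -> cell k p = c.
  by move=> cc pc; have := cell_children k p; rewrite pc => /children_inj; exact.
have L0 : nonneg_on (fun p => E p /\ cell k p = c) L.
  move=> x /flattenP[_ /mapP[c' cc ->] xL].
  have [/(_ x xL)[x0 [Ex xc]] _ _] := hL c'.
  by split => //; split => //; exact: child_parent xc.
have Lm : mass L xpredT = t.
  rewrite mass_flatten -ttS; apply: eq_bigr => c' _.
  by have [_ -> _] := hL c'.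
exists L; split => // k' c' /andP[kk kd].
have [<-|kk'] := eqVneq k k'; first by rewrite (le_trans (mass_le _ L0))// Lm.
have {kk kk'}kk : (k.+1 <= k')%N by rewrite ltn_neqAle kk'.
pose a := ancestor k.+1 k' c'.
rewrite mass_flatten; apply: (@le_trans _ _
  (\sum_(c1 <- children c) (if c1 == a then b ^+ k' else 0))).
  apply: ler_sum => c1 _; have [h1 _ h3] := hL c1; case: ifPn => [_|c1a].
    by apply: h3; rewrite kk/= addSnnS.
  rewrite /mass big_seq_cond big1// => x /andP[xL /eqP xc].
  have [_ [_ xc1]] := h1 x xL; case/eqP: c1a.
  by rewrite -xc1 /a -xc -cell_ancestor.
rewrite -big_mkcond/= big_const_seq.
have : (count (fun c1 => c1 == a) (children c) <= 1)%N.
  by rewrite (count_uniq_mem a (children_uniq c)); case: (_ \in _).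
case: (count _ _) => [|[|//]] _ /=; first by rewrite exprn_ge0// ltW.
by rewrite addr0.
Qed.

End recursion.

Lemma hausdorff_pre_le_diam (s delta : R) (A : set (R * R)) :
  (ediam A <= delta%:E)%E -> (hausdorff_pre s delta A <= diam_pow s A)%E.
Proof.
move=> Ad; apply: (@le_trans _ _
    (\sum_(k <oo) diam_pow s (if k is 0%N then A else set0))%E).
  apply: ereal_inf_lbound; exists (fun k => if k is 0%N then A else set0) => //.
  split; first by move=> p Ap; exists 0%N.
  by case=> [|k] //; rewrite ediam0 leNye.
rewrite (@nneseriesD1 _ _ 0%N)//; last by move=> *; exact: diam_pow_ge0.
by rewrite eseries0 ?adde0// => -[|k] _ //= _; rewrite diam_pow0.
Qed.

Lemma hausdorff_pre_setU (s delta : R) (A B : set (R * R)) :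
  (hausdorff_pre s delta (A `|` B) <=
   hausdorff_pre s delta A + hausdorff_pre s delta B)%E.
Proof.
pose F k := if k is 0%N then A else if k is 1%N then B else set0.
have -> : A `|` B = \bigcup_k F k.
  apply/seteqP; split => [p [Ap|Bp]|p [[|[|k]] _ //=]];
    [by exists 0%N|by exists 1%N|by left|by right].
apply: (le_trans (hausdorff_pre_sigma_subadditive s delta F)).
rewrite (nneseries_split 0%N 2); last by move=> *; exact: hausdorff_pre_ge0.
rewrite add0n [X in (_ + X)%E]eseries0 ?adde0; last first.
  by move=> [|[|k]] //= _ _; rewrite hausdorff_pre0.
by rewrite big_nat_recr//= big_nat1.
Qed.

Lemma hausdorff_pre_seq (s delta : R) (I : eqType) (cs : seq I)
    (B : I -> set (R * R)) (A : set (R * R)) :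
  (forall p, A p -> exists2 c, c \in cs & B c p) ->
  (hausdorff_pre s delta A <= \sum_(c <- cs) hausdorff_pre s delta (B c))%E.
Proof.
elim: cs A => [|c cs IH] A AB.
  rewrite big_nil (_ : A = set0) ?hausdorff_pre0//.
  by rewrite -subset0 => p /AB[].
rewrite big_cons; apply: (@le_trans _ _ (hausdorff_pre s delta (B c) +
    hausdorff_pre s delta (A `\` B c))%E).
  apply: (le_trans _ (hausdorff_pre_setU _ _ _ _)); apply: le_hausdorff_pre => p Ap.
  by have [Bp|Bp] := pselect (B c p); [left|right].
rewrite leeD2l//; apply: IH => p [Ap nB].
have [c' + Bp] := AB p Ap; rewrite inE => /predU1P[cc|cc]; first by case: nB; rewrite -cc.
by exists c'.
Qed.

Lemma ediam_cell k c : (ediam [set p | cell k p = c] <= (2 * 2^-1 ^+ k : R)%:E)%E.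
Proof.
apply: ediam_le => p q /= pc qc; apply: (le_trans (enorm_le _)).
have p0 : (0 : R) < 2 ^+ k by rewrite exprn_gt0.
have key (x y : R) : Num.floor (2 ^+ k * x) = Num.floor (2 ^+ k * y) ->
    `|x - y| <= 2^-1 ^+ k.
  move=> xy; have := floor_itv (2 ^+ k * x); have := floor_itv (2 ^+ k * y).
  rewrite xy !intrD => /andP[h1 h2] /andP[h3 h4].
  rewrite exprVn -[leRHS]mul1r ler_pdivlMr// -[X in _ * X](gtr0_norm p0) -normrM.
  by rewrite ler_norml; apply/andP; split; lra.
have := pc; rewrite -qc => -[/key h1 /key h2].
by rewrite mulrDl !mul1r; exact: lerD h1 h2.
Qed.

Lemma hausdorff_pre_cell (s delta : R) k E c : 0 <= s -> 2 * 2^-1 ^+ k <= delta ->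
  (hausdorff_pre s delta (E `&` [set p | cell k p = c]) <=
    (2 `^ s * (2^-1 `^ s) ^+ k)%:E)%E.
Proof.
move=> s0 kd; set A := E `&` _.
have Ad : (ediam A <= (2 * 2^-1 ^+ k : R)%:E)%E.
  apply: le_trans (ediam_cell k c); apply: ge_ereal_sup => _ [p [_ pA] [q [_ qA] <-]].
  exact: ediam_ub.
apply: (@le_trans _ _ (diam_pow s A)).
  by apply: hausdorff_pre_le_diam; apply: (le_trans Ad); rewrite lee_fin.
rewrite /diam_pow; case: ifPn => [_|/set0P A0].
  by rewrite lee_fin mulr_ge0 ?exprn_ge0 ?powR_ge0.
have [e Ae e0] := ediam_fin A0 Ad.
have -> : 2 `^ s * (2^-1 `^ s) ^+ k = (2 * 2^-1 ^+ k) `^ s :> R.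
  rewrite powRM ?half_exp_ge0//; congr (_ * _).
  have h0 : 0 <= 2^-1 :> R by rewrite invr_ge0.
  rewrite -(powR_mulrn k (powR_ge0 (2^-1 : R) s)) -(powR_mulrn k h0).
  by rewrite -powRrM mulrC powRrM.
rewrite Ae poweR_EFin lee_fin.
apply: ge0_ler_powR; rewrite ?nnegrE ?mulr_ge0 ?half_exp_ge0//.
by rewrite -lee_fin -Ae.
Qed.

(** Min cut: the cells at which the minimum in [flow] is attained by [b ^+ k]
    form a cover of E in the cell. *)
Lemma hausdorff_pre_flow (s delta : R) E d k c : 0 <= s ->
  2 * 2^-1 ^+ k <= delta ->
  (hausdorff_pre s delta (E `&` [set p | cell k p = c]) <=
    (2 `^ s * flow (2^-1 `^ s) E d k c)%:E)%E.
Proof.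
move=> s0; elim: d k c => [|d IH] k c kd /=.
  case: ifPn => [_|/asboolP nE]; first exact: hausdorff_pre_cell.
  rewrite (_ : E `&` _ = set0) ?hausdorff_pre0 ?mulr0//.
  by rewrite -subset0 => p [Ep pc]; apply: nE; exists p.
case: (leP ((2^-1 `^ s) ^+ k) _) => _; first exact: hausdorff_pre_cell.
have kd' : 2 * 2^-1 ^+ k.+1 <= delta.
  apply: le_trans kd; rewrite ler_wpM2l// exprS ler_piMl ?half_exp_ge0//.
  by rewrite invf_le1// ler1n.
apply: (@le_trans _ _ (\sum_(c' <- children c)
    hausdorff_pre s delta (E `&` [set p | cell k.+1 p = c']))%E).
  apply: hausdorff_pre_seq => p [Ep /= pc]; exists (cell k.+1 p) => //.
  by rewrite -pc; exact: cell_children.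
rewrite mulr_sumr -sumEFin; apply: lee_sum => c' _; exact: IH.
Qed.

(** Some dyadic cell of diameter at most delta has positive s-dimensional
    delta-content; up to a factor 2^s, that content is a lower bound,
    independent of the depth, for the capacity of the cell. *)
Theorem finite_frostman (s : R) E : 0 < s -> (0 < hausdorff s E)%E ->
  exists (k0 : nat) (kappa : R), 0 < kappa /\ forall d, exists L,
    [/\ nonneg_on E L, mass L xpredT = kappa &
      forall k c, (k0 <= k <= k0 + d)%N ->
        mass L (fun p => cell k p == c) <= (2^-1 `^ s) ^+ k].
Proof.
move=> s0 /ereal_sup_gt[_ [delta /= delta0 <-] Ed].
have [k0 hk0] := half_expn_lt (divr_gt0 delta0 (ltr0n R 2)).
have kd : 2 * 2^-1 ^+ k0 <= delta.
  by have := hk0 k0 (leqnn _); rewrite ltr_pdivlMr// mulrC => /ltW.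
have [c Ec] : exists c,
    (0 < hausdorff_pre s delta (E `&` [set p | cell k0 p = c]))%E.
  apply: contrapT => no; move: Ed; rewrite ltNge => /negP; apply.
  pose F n := if (unpickle n : option (int * int)) is Some c
    then E `&` [set p | cell k0 p = c] else set0.
  apply: (@le_trans _ _ (hausdorff_pre s delta (\bigcup_n F n))).
    apply: le_hausdorff_pre => p Ep; exists (pickle (cell k0 p)); first exact: I.
    by rewrite /F pickleK; split.
  apply: (le_trans (hausdorff_pre_sigma_subadditive s delta F)).
  rewrite eseries0// => n _ _; rewrite /F; case: (unpickle n) => [c|];
    last exact: hausdorff_pre0.
  apply/eqP; rewrite eq_le hausdorff_pre_ge0 andbT leNgt; apply/negP => h.
  by apply: no; exists c.
have Efin : hausdorff_pre s delta (E `&` [set p | cell k0 p = c]) \is a fin_num.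
  rewrite ge0_fin_numE ?hausdorff_pre_ge0//.
  by rewrite (le_lt_trans (hausdorff_pre_cell _ _ (ltW s0) kd))// ltry.
have p2 : 0 < 2 `^ s :> R by rewrite powR_gt0.
exists k0, (fine (hausdorff_pre s delta (E `&` [set p | cell k0 p = c])) / 2 `^ s).
split; first by rewrite divr_gt0// fine_gt0// Ec/= -ge0_fin_numE ?hausdorff_pre_ge0.
move=> d; have b0 : 0 < 2^-1 `^ s :> R by rewrite powR_gt0.
have := hausdorff_pre_flow E d c (ltW s0) kd.
rewrite -(fineK Efin) lee_fin mulrC -ler_pdivrMr// => h.
have h0 : 0 <= fine (hausdorff_pre s delta (E `&` [set p | cell k0 p = c])) / 2 `^ s.
  by rewrite divr_ge0 ?fine_ge0 ?hausdorff_pre_ge0// ltW.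
have [L [L1 L2 L3]] := flow_measure b0 (introT andP (conj h0 h)).
by exists L; split => // x /L1[? []].
Qed.

End frostman.

(** * Measurability and area in the plane *)

Section plane_measurability.
Context {R : realType}.
Local Notation plane := (measurableTypeR R * measurableTypeR R)%type.
Local Notation leb := (@lebesgue_measure R).
Implicit Types (p q z : R * R).

Definition rat_box (a : rat * rat * (rat * rat)) : set (R * R) :=
  `]ratr a.1.1, ratr a.1.2[%classic `*` `]ratr a.2.1, ratr a.2.2[%classic.

Lemma open_plane_measurable (U : set (R * R)) : open U -> measurable (U : set plane).
Proof.
move=> oU.
pose F n := if (unpickle n : option (rat * rat * (rat * rat))) is Some a then
  if `[< rat_box a `<=` U >] then rat_box a else set0 else set0.
have -> : U = \bigcup_n F n.
  apply/seteqP; split => [z Uz|z [n _]]; last first.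
    rewrite /F; case: (unpickle n) => // a.
    by case: ifPn => // /asboolP h /h.
  have : nbhs z U by exact: open_nbhs_nbhs.
  case=> -[A B] /= [/nbhs_ballP[e1 /= e10 h1] /nbhs_ballP[e2 /= e20 h2]] hAB.
  have bnd (x e : R) : 0 < e -> exists a b : rat,
      [/\ x - e < ratr a, ratr a < x, x < ratr b & ratr b < x + e].
    move=> e0.
    have /rat_in_itvoo[a] : x - e < x by lra.
    have /rat_in_itvoo[b] : x < x + e by lra.
    by rewrite !in_itv/= => /andP[b1 b2] /andP[a1 a2]; exists a, b.
  have [a1 [b1 [l1 l2 l3 l4]]] := bnd z.1 e1 e10.
  have [a2 [b2 [m1 m2 m3 m4]]] := bnd z.2 e2 e20.
  pose a := ((a1, b1), (a2, b2)).
  have sub : rat_box a `<=` U.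
    move=> w [/=]; rewrite !in_itv/= => /andP[w1 w2] /andP[w3 w4].
    apply: hAB; split => /=.
      by apply: h1; rewrite /ball/= ltr_norml; apply/andP; split; lra.
    by apply: h2; rewrite /ball/= ltr_norml; apply/andP; split; lra.
  exists (pickle a); first exact: I.
  rewrite /F pickleK; case: ifPn => [_|/asboolP//].
  by split; rewrite /= in_itv/=; apply/andP; split.
apply: bigcup_measurable => n _; rewrite /F; case: (unpickle n) => // a.
by case: ifPn => // _; apply: measurableX; exact: measurable_itv.
Qed.

Lemma closed_plane_measurable (C : set (R * R)) : closed C -> measurable (C : set plane).
Proof.
move=> cC; rewrite -(setCK C); apply: measurableC.
by apply: open_plane_measurable; exact: closed_openC.
Qed.

Lemma compact_plane_measurable (K : set (R * R)) : compact K ->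
  measurable (K : set plane).
Proof.
move=> cK; apply: closed_plane_measurable; apply: compact_closed cK.
exact: norm_hausdorff.
Qed.

Lemma compact_plane_finite (K : set (R * R)) : compact K ->
  (planar_lebesgue K < +oo)%E.
Proof.
move=> cK; have [M [Mr hM]] := compact_bounded cK.
pose B : set R := `[- (`|M| + 1), `|M| + 1]%classic.
have KB : K `<=` B `*` B.
  move=> z Kz; have : `|z| <= `|M| + 1.
    by apply: hM Kz; rewrite (le_lt_trans (ler_norm M))// ltrDl.
  rewrite prod_normE ge_max => /andP[z1 z2].
  by split; rewrite /B/= in_itv/= -ler_norml.
have mB : measurable (B : set (measurableTypeR R)) by exact: measurable_itv.
apply: (@le_lt_trans _ _ (planar_lebesgue (B `*` B))).
  apply: (@le_measure _ _ _ (leb \x leb)%E); rewrite ?inE//.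
    exact: compact_plane_measurable.
  exact: measurableX.
have Bfin : (leb B < +oo)%E.
  by rewrite lebesgue_measure_itv/=; case: ifPn => _; rewrite ?ltry// -EFinB ltry.
have Bfn : leb B \is a fin_num by rewrite ge0_fin_numE.
rewrite /planar_lebesgue product_measure1E//.
exact: (lte_mul_pinfty (measure_ge0 _ _) Bfn Bfin).
Qed.

Lemma planar_lebesgue_thin (A : set (R * R)) (a c r : R) (m : R -> R) :
  measurable (A : set plane) -> a <= c -> 0 <= r ->
  (forall z, A z -> a <= z.1 <= c /\ `|z.2 - m z.1| <= r) ->
  (planar_lebesgue A <= ((c - a) * (2 * r))%:E)%E.
Proof.
move=> mA ac r0 hA; rewrite /planar_lebesgue /product_measure1.
have mac : measurable (`[a, c]%classic : set (measurableTypeR R))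
  by exact: measurable_itv.
apply: (@le_trans _ _ (\int[leb]_(x in `[a, c]) cst (2 * r)%:E x)%E).
  rewrite [leRHS]integral_mkcond; apply: ge0_le_integral => //.
  - exact: measurable_fun_xsection.
  - by apply/(measurable_restrictT _ _).1 => //; exact: measurable_cst.
  move=> x _ /=; rewrite patchE.
  have mS : measurable (xsection A x) by exact: measurable_xsection.
  case: ifPn => [_|xac].
    apply: (@le_trans _ _ (leb `[m x - r, m x + r]%classic)).
      apply: le_measure; rewrite ?inE//.
      move=> y /xsectionP/hA[_ /=]; rewrite in_itv/= ler_norml => /andP[y1 y2].
      by apply/andP; split; lra.
    by rewrite lebesgue_measure_itv/=; case: ifPn => _; rewrite -?EFinB lee_fin; lra.
  rewrite (_ : xsection A x = set0) ?measure0//.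
  rewrite -subset0 => y /xsectionP/hA[/= xac' _].
  by move/negP: xac; apply; rewrite inE /= in_itv.
rewrite integral_cst//= lebesgue_measure_itv/= lte_fin.
case: ltP => [_|ca]; first by rewrite -EFinB -EFinM mulrC.
by rewrite mule0 lee_fin mulr_ge0 ?subr_ge0// mulr_ge0.
Qed.

End plane_measurability.

(** * Transversality of the translated curves *)

Section transversality.
Context {R : realType}.
Local Notation plane := (measurableTypeR R * measurableTypeR R)%type.
Local Notation leb := (@lebesgue_measure R).
Local Notation gamma := (@gamma R).
Local Notation lip := (@lip R).
Implicit Types (p q z : R * R) (r : R).

(** The restriction to [core] is what makes the strips of distinct points
    transversal; it still keeps a part of positive length of each curve. *)
Definition strip r p : set (R * R) :=
  [set z | core (z.1 - p.1) /\ `|z.2 - (p.2 + gamma (z.1 - p.1))| <= r].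

Lemma gamma_continuous : continuous gamma.
Proof.
have l0 : 0 < lip by apply: lt_le_trans (lip_ge1).
move=> x; apply/cvgrPdist_lt => e e0; near=> y.
apply: (le_lt_trans (gamma_lipschitz x y)).
rewrite mulrC -ltr_pdivlMr//; near: y.
by apply/nbhs_ballP; exists (e / lip) => /=; [exact: divr_gt0|].
Unshelve. all: by end_near. Qed.

Lemma core_itv (x : R) : core x -> 1 <= x <= 2.
Proof. by case=> /=; rewrite in_itv. Qed.

Lemma strip_measurable r p : measurable (strip r p : set plane).
Proof.
have mfst : measurable_fun setT (fun z : plane => z.1 - p.1 : measurableTypeR R).
  by apply: measurable_funB => //; exact: measurable_fst.
rewrite (_ : strip r p = [set z : plane | core (z.1 - p.1)] `&`
   [set z : plane | `|z.2 - (p.2 + gamma (z.1 - p.1))| <= r])//.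
apply: measurableI.
  by have := mfst measurableT _ (measurable_core); rewrite setTI.
have mg : measurable_fun setT (gamma : measurableTypeR R -> R).
  by apply: continuous_measurable_fun; exact: gamma_continuous.
have : measurable_fun setT (fun z : plane => `|z.2 - (p.2 + gamma (z.1 - p.1))|).
  apply: measurableT_comp => //; apply: measurable_funB; first exact: measurable_snd.
  by apply: measurable_funD => //; apply: (measurableT_comp mg).
move=> /(_ measurableT `]-oo, r]%classic (measurable_itv _)).
by rewrite setTI; congr measurable; apply/seteqP; split => z /=; rewrite in_itv.
Qed.

Lemma strip_ge r p : 0 < r -> (r%:E <= planar_lebesgue (strip r p))%E.
Proof.
move=> r0; rewrite /planar_lebesgue /product_measure1.
pose S : set (measurableTypeR R) := [set x : R | core (x - p.1)].
have mS : measurable S.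
  have : measurable_fun setT (fun x : measurableTypeR R => x - p.1 : measurableTypeR R).
    exact: measurable_funB.
  by move=> /(_ measurableT _ (measurable_core)); rewrite setTI.
apply: (@le_trans _ _ (\int[leb]_(x in S) cst (2 * r)%:E x)%E).
  rewrite integral_cst// -(@lee_pmul2l _ (2 * r)^-1%:E)//; last first.
    by rewrite lte_fin invr_gt0 mulr_gt0.
  rewrite muleA -!EFinM mulVf ?mul1e; last by rewrite gt_eqF// mulr_gt0.
  apply: le_trans (lebesgue_core_shift p.1); rewrite lee_fin le_eqVlt; apply/orP; left.
  by apply/eqP; field; rewrite gt_eqF.
rewrite [leLHS]integral_mkcond; apply: ge0_le_integral => //.
- by move=> x _; rewrite erestrict_ge0// => y _; rewrite lee_fin mulr_ge0// ltW.
- by apply/(measurable_restrictT _ _).1 => //; exact: measurable_cst.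
- by apply: measurable_fun_xsection; exact: strip_measurable.
move=> x _; rewrite patchE /=; case: ifPn => [/set_mem Sx|_]; last exact: measure_ge0.
rewrite (_ : xsection _ _ = `[p.2 + gamma (x - p.1) - r, p.2 + gamma (x - p.1) +
  r]%classic).
  by rewrite lebesgue_measure_itv/= lte_fin -EFinB ifT; [rewrite lee_fin|]; lra.
apply/seteqP; split => [y /xsectionP[_ /= h]|y /= h].
  by rewrite in_itv/= -ler_distl.
by apply/xsectionP; split => //=; rewrite ler_distl; move: h; rewrite in_itv.
Qed.

Lemma strip_meet_le r p q : 0 <= r ->
  (planar_lebesgue (strip r p `&` strip r q) <= (2 * r)%:E)%E.
Proof.
move=> r0; have -> : 2 * r = (2 + p.1 - (1 + p.1)) * (2 * r) by ring.
apply: (@planar_lebesgue_thin _ _ _ _ _ (fun x => p.2 + gamma (x - p.1))) => //.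
- by apply: measurableI; exact: strip_measurable.
- by lra.
- move=> z [[/core_itv/andP[h1 h2] h3] _]; split => //.
  by apply/andP; split; lra.
Qed.

(** Two points of the intersection: the difference of the two translated
    functions varies by at most 4 r between their abscissas, and this variation
    is a mixed second difference of gamma with outer points z'.1 - q.1 and z.1
    - p.1, both in [core]. *)
Lemma strip_meet_sep r p q z z' : 0 <= r -> p.1 < q.1 -> z'.1 <= z.1 ->
  (strip r p `&` strip r q) z -> (strip r p `&` strip r q) z' ->
  (z.1 - z'.1) * (q.1 - p.1) <= 8 * r.
Proof.
move=> r0 pq zz [[cp hp] [cq hq]] [[cp' hp'] [cq' hq']].
have tau0 : 0 <= q.1 - p.1 by lra.
have vw : z'.1 - q.1 + (q.1 - p.1) <= z.1 - p.1 by lra.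
have := gamma_mixed cq' cp tau0 vw.
have -> : z'.1 - q.1 + (q.1 - p.1) = z'.1 - p.1 by ring.
have -> : z.1 - p.1 - (q.1 - p.1) = z.1 - q.1 by ring.
have -> : z.1 - p.1 - (z'.1 - q.1) - (q.1 - p.1) = z.1 - z'.1 by ring.
rewrite mulrC.
move: hp hq hp' hq'; rewrite !ler_norml =>
  /andP[a1 a2] /andP[a3 a4] /andP[a5 a6] /andP[a7 a8].
move: (gamma _) (gamma _) (gamma _) (gamma _) a1 a2 a3 a4 a5 a6 a7 a8 => g1 g2 g3 g4.
set X := (q.1 - p.1) * _; have -> : (z.1 - z'.1) * (q.1 - p.1) = X by rewrite mulrC.
lra.
Qed.

(** If p - q is steep, the Lipschitz curves stay at vertical distance at least
    d / 2, so the intersection is empty unless d <= 4 r, in which case the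
    trivial bound 1 on the width suffices. Otherwise d <= 2 lip |p.1 - q.1| and
    [strip_meet_sep] applies. *)
Lemma strip_meet_width r p q z z' (d : R) : 0 < r -> 0 < d ->
  d = Num.max `|p.1 - q.1| `|p.2 - q.2| ->
  (strip r p `&` strip r q) z -> (strip r p `&` strip r q) z' ->
  `|z.1 - z'.1| <= 16 * lip * r / d.
Proof.
move=> r0 d0 dE hz hz'.
have l1 : 1 <= lip := lip_ge1.
have [hV|hH] := leP (2 * lip * `|p.1 - q.1|) `|p.2 - q.2|.
  have dE2 : d = `|p.2 - q.2|.
    rewrite dE; apply/max_idPr; apply: le_trans hV.
    by rewrite ler_peMl//; lra.
  have d4 : d <= 4 * r.
    have [[_ h1] [_ h2]] := hz.
    have h3 := gamma_lipschitz (z.1 - p.1) (z.1 - q.1).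
    have E : z.1 - p.1 - (z.1 - q.1) = - (p.1 - q.1) by ring.
    rewrite E normrN in h3.
    move: h1 h2 h3; rewrite !ler_norml => /andP[a1 a2] /andP[a3 a4] /andP[a5 a6].
    rewrite dE2; move: hV; set Y := lip * `|p.1 - q.1| in a5 a6 *.
    rewrite -mulrA -/Y; have [?|?] := ger0P (p.2 - q.2); lra.
  have w1 : `|z.1 - z'.1| <= 1.
    have [[/core_itv/andP[a1 a2] _] _] := hz.
    have [[/core_itv/andP[a3 a4] _] _] := hz'.
    by rewrite ler_norml; apply/andP; split; lra.
  apply: (le_trans w1); rewrite ler_pdivlMr// mul1r (le_trans d4)//.
  by rewrite ler_pM2r//; lra.
have n0 : 0 < `|p.1 - q.1|.
  rewrite normr_gt0; apply/eqP => e; move: hH; rewrite e normr0 mulr0.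
  by rewrite ltNge normr_ge0.
have key : `|z.1 - z'.1| * `|p.1 - q.1| <= 8 * r.
  move: z z' p q hz hz' n0 {hH dE}; suff W z z' p q : p.1 < q.1 ->
      (strip r p `&` strip r q) z -> (strip r p `&` strip r q) z' ->
      `|z.1 - z'.1| * `|p.1 - q.1| <= 8 * r.
    move=> z z' p q hz hz'; rewrite normr_gt0 subr_eq0 neq_lt => /orP[pq|qp].
      exact: W.
    by rewrite [X in _ * X]distrC; apply: W => //; rewrite setIC.
  move=> pq hz hz'; rewrite distrC (ltr0_norm (_ : p.1 - q.1 < 0)) ?subr_lt0// opprB.
  have [zz|zz] := leP z'.1 z.1.
    by rewrite distrC ger0_norm ?subr_ge0//; exact: strip_meet_sep (ltW r0) pq zz hz hz'.
  by rewrite gtr0_norm ?subr_gt0//; exact: strip_meet_sep (ltW r0) pq (ltW zz) hz' hz.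
have dle : d <= 2 * lip * `|p.1 - q.1|.
  by rewrite dE ge_max (ltW hH) andbT ler_peMl//; lra.
rewrite ler_pdivlMr//.
apply: (@le_trans _ _ (`|z.1 - z'.1| * (2 * lip * `|p.1 - q.1|))).
  by rewrite ler_wpM2l.
have -> : `|z.1 - z'.1| * (2 * lip * `|p.1 - q.1|) =
  2 * lip * (`|z.1 - z'.1| * `|p.1 - q.1|) by ring.
have -> : 16 * lip * r = 2 * lip * (8 * r) by ring.
by rewrite ler_wpM2l//; lra.
Qed.

Lemma strip_transversality r p q (d : R) : 0 < r -> 0 < d ->
  d = Num.max `|p.1 - q.1| `|p.2 - q.2| ->
  (planar_lebesgue (strip r p `&` strip r q) <= (64 * lip * r ^+ 2 / d)%:E)%E.
Proof.
move=> r0 d0 dE.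
have l1 : 1 <= lip := lip_ge1.
have D0 : 0 <= 16 * lip * r / d by rewrite divr_ge0 ?mulr_ge0//; lra.
have [[z0 hz0]|no] := pselect ((strip r p `&` strip r q) !=set0); last first.
  rewrite (_ : _ `&` _ = set0).
    rewrite /planar_lebesgue measure0 lee_fin.
    by rewrite divr_ge0 ?mulr_ge0 ?exprn_ge0//; lra.
  by rewrite -subset0 => z hz; case: no; exists z.
have -> : 64 * lip * r ^+ 2 / d =
  (z0.1 + 16 * lip * r / d - (z0.1 - 16 * lip * r / d)) * (2 * r) by field;
    rewrite gt_eqF.
apply: (@planar_lebesgue_thin _ _ _ _ _ (fun x => p.2 + gamma (x - p.1))) => //.
- by apply: measurableI; exact: strip_measurable.
- by lra.
- exact: ltW.
- move=> z hz; split; last by case: hz => -[].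
  have := strip_meet_width r0 d0 dE hz hz0; rewrite ler_norml => /andP[h1 h2].
  by apply/andP; split; lra.
Qed.

End transversality.

(** * Energy estimates *)

Section energy.
Context {R : realType}.
Local Notation plane := (measurableTypeR R * measurableTypeR R)%type.
Local Notation leb := (@lebesgue_measure R).
Local Notation gamma := (@gamma R).
Local Notation lip := (@lip R).
Implicit Types (p q z : R * R) (n k : nat).

Definition supdist p q : R := Num.max `|p.1 - q.1| `|p.2 - q.2|.

(** A dyadic majorant, up to a factor 2, of the Riesz kernel 1 / |p - q|
    truncated at the scales 2^-k0 and 2^-n. *)
Definition dyadic_kernel k0 n p q : R :=
  2 ^+ k0 + \sum_(k0 <= k < n.+1) (if supdist p q <= 2^-1 ^+ k then 2 ^+ k else 0).

Lemma inv_dist_dyadic k0 n (d : R) : (k0 <= n)%N -> 2^-1 ^+ n < d ->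
  d^-1 <= 2 * (2 ^+ k0 + \sum_(k0 <= k < n) (if d <= 2^-1 ^+ k then 2 ^+ k else 0)).
Proof.
have half_inv m (x : R) : 2^-1 ^+ m < x -> x^-1 <= 2 ^+ m.
  move=> mx; have x0 : 0 < x := lt_trans (half_exp_gt0 m) mx.
  have -> : 2 ^+ m = (2^-1 ^+ m)^-1 :> R by rewrite exprVn invrK.
  by rewrite lef_pV2 ?posrE ?half_exp_gt0// ltW.
have p0 m : (0 : R) < 2 ^+ m by rewrite exprn_gt0.
elim: n => [|n IH].
  rewrite leqn0 => /eqP -> /half_inv h; rewrite big_geq// addr0.
  by have := p0 0%N; lra.
rewrite leq_eqVlt => /predU1P[-> /half_inv h|].
  by rewrite big_geq// addr0; have := p0 n.+1; lra.
rewrite ltnS => kn dn; rewrite big_nat_recr//=.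
have [nd|nd] := ltP (2^-1 ^+ n) d.
  by have := IH kn nd; lra.
have S0 : 0 <= \sum_(k0 <= k < n) (if d <= 2^-1 ^+ k then 2 ^+ k else 0 : R).
  by apply: sumr_ge0 => k _; case: ifP => // _; exact: ltW.
have := half_inv _ _ dn; rewrite exprS; have := p0 k0; lra.
Qed.

Lemma strip_meet_kernel k0 n p q : (k0 <= n)%N ->
  (planar_lebesgue (strip (2^-1 ^+ n) p `&` strip (2^-1 ^+ n) q) <=
   (128 * lip * (2^-1 ^+ n) ^+ 2 * dyadic_kernel k0 n p q)%:E)%E.
Proof.
move=> kn; have l1 : 1 <= lip := lip_ge1.
set r : R := 2^-1 ^+ n; have r0 : 0 < r by exact: half_exp_gt0.
have p0 m : (0 : R) < 2 ^+ m by rewrite exprn_gt0.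
have S0 m : 0 <= \sum_(k0 <= k < m) (if supdist p q <= 2^-1 ^+ k then 2 ^+ k else 0 : R).
  by apply: sumr_ge0 => k _; case: ifP => // _; exact: ltW.
have [dr|rd] := leP (supdist p q) r.
  apply: le_trans (strip_meet_le p q (ltW r0)) _; rewrite lee_fin.
  rewrite /dyadic_kernel big_nat_recr//= dr.
  have rn : r * 2 ^+ n = 1 by rewrite /r exprVn mulVf// gt_eqF.
  apply: (@le_trans _ _ (128 * lip * r ^+ 2 * 2 ^+ n)).
    by rewrite expr2 -!mulrA rn mulr1 mulrA ler_pM2r//; lra.
  rewrite ler_wpM2l//; first by rewrite !mulr_ge0 ?exprn_ge0 ?(ltW r0)//; lra.
  by have := S0 n; have := p0 k0; lra.
have d0 : 0 < supdist p q by exact: lt_trans rd.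
apply: le_trans (strip_transversality r0 d0 erefl) _; rewrite lee_fin.
have -> : 128 * lip * r ^+ 2 * dyadic_kernel k0 n p q =
  64 * lip * r ^+ 2 * (2 * dyadic_kernel k0 n p q) by ring.
rewrite ler_wpM2l//; first by rewrite !mulr_ge0 ?exprn_ge0 ?(ltW r0)//; lra.
apply: (le_trans (inv_dist_dyadic kn rd)); rewrite ler_wpM2l//.
rewrite /dyadic_kernel lerD2l big_nat_recr//= lerDl.
by case: ifP => // _; exact: ltW.
Qed.

Definition neighbors (c : int * int) : seq (int * int) :=
  [seq (i, j) | i <- [:: c.1 - 1; c.1; c.1 + 1], j <- [:: c.2 - 1; c.2; c.2 + 1]].

Lemma cell_neighbors k p q : supdist p q <= 2^-1 ^+ k ->
  cell k q \in neighbors (cell k p).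
Proof.
rewrite ge_max => /andP[h1 h2].
have p0 : (0 : R) < 2 ^+ k by rewrite exprn_gt0.
have key (x y : R) : `|x - y| <= 2^-1 ^+ k -> Num.floor (2 ^+ k * y) \in
    [:: Num.floor (2 ^+ k * x) - 1; Num.floor (2 ^+ k * x); Num.floor (2 ^+ k * x) + 1].
  move=> xy; have {}xy : `|2 ^+ k * x - 2 ^+ k * y| <= 1.
    by rewrite -mulrBr normrM (gtr0_norm p0) mulrC -ler_pdivlMr// div1r -exprVn.
  move: xy; rewrite ler_norml => /andP[a1 a2].
  have /andP[b1 b2] := floor_itv (2 ^+ k * x).
  have /andP[b3 b4] := floor_itv (2 ^+ k * y).
  have : Num.floor (2 ^+ k * y) < Num.floor (2 ^+ k * x) + 2.
    by rewrite floor_lt_int intrD; move: b2; rewrite intrD; lra.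
  have : Num.floor (2 ^+ k * x) < Num.floor (2 ^+ k * y) + 2.
    by rewrite floor_lt_int intrD; move: b4; rewrite intrD; lra.
  rewrite !inE; lia.
by apply/allpairsP; exists (cell k q); split => //=; exact: key.
Qed.

(** A ball of radius 2^-k in the sup norm meets at most 9 cells of level k. *)
Lemma mass_ball E (L : seq (R * (R * R))) k p (B : R) : nonneg_on E L ->
  (forall c, mass L (fun q => cell k q == c) <= B) ->
  mass L (fun q => supdist p q <= 2^-1 ^+ k) <= 9 * B.
Proof.
move=> L0 LB.
apply: (@le_trans _ _ (\sum_(c <- neighbors (cell k p))
    mass L (fun q => cell k q == c))); last first.
  apply: (@le_trans _ _ (\sum_(c <- neighbors (cell k p)) B)).
    by apply: ler_sum => c _.
  by rewrite /neighbors /= !big_cons big_nil; lra.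
rewrite /mass; under [leRHS]eq_bigr do rewrite big_mkcond/=.
rewrite [leRHS]exchange_big/= big_mkcond/= big_seq [leRHS]big_seq.
apply: ler_sum => x /L0[x0 _].
case: ifPn => [/cell_neighbors h|_]; last first.
  by apply: sumr_ge0 => c _; case: ifP.
rewrite (big_rem (cell k x.2))//= eqxx lerDl.
by apply: sumr_ge0 => c _; case: ifP.
Qed.

(** The balls of radius 2^-k contribute 9 (2 b)^k, and 2 b < 1; for b = 2^-s
    this is the condition s > 1. *)
Lemma energy_bound E (L : seq (R * (R * R))) k0 n p (b : R) :
  0 <= b -> 2 * b < 1 -> nonneg_on E L ->
  (forall k c, (k0 <= k <= n)%N -> mass L (fun q => cell k q == c) <= b ^+ k) ->
  \sum_(x <- L) x.1 * dyadic_kernel k0 n p x.2 <=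
  2 ^+ k0 * mass L xpredT + 9 / (1 - 2 * b).
Proof.
move=> b0 b1 L0 LB.
have p0 m : (0 : R) < 2 ^+ m by rewrite exprn_gt0.
rewrite /dyadic_kernel; under eq_bigr do rewrite mulrDr.
rewrite big_split/=; apply: lerD.
  by rewrite -mulr_suml mulrC.
under eq_bigr do rewrite mulr_sumr.
rewrite exchange_big/=.
apply: (@le_trans _ _ (\sum_(k0 <= k < n.+1) 9 * (2 * b) ^+ k)).
  rewrite big_nat_cond [leRHS]big_nat_cond.
  apply: ler_sum => k; rewrite andbT ltnS => kn.
  rewrite exprMn mulrCA.
  have -> : \sum_(x <- L) x.1 * (if supdist p x.2 <= 2^-1 ^+ k then 2 ^+ k else 0) =
      2 ^+ k * mass L (fun q => supdist p q <= 2^-1 ^+ k).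
    rewrite /mass [in RHS]big_mkcond/= mulr_sumr; apply: eq_bigr => x _.
    by case: ifP; rewrite ?mulr0// mulrC.
  by rewrite ler_wpM2l ?(ltW (p0 k))//; apply: mass_ball L0 _ => c; exact: LB.
rewrite -mulr_sumr ler_wpM2l//.
have b20 : 0 <= 2 * b by rewrite mulr_ge0.
apply: (@le_trans _ _ (\sum_(0 <= k < n.+1) (2 * b) ^+ k)).
  have [kn|kn] := leqP k0 n.+1; last first.
    by rewrite big_geq 1?ltnW// sumr_ge0// => k _; rewrite exprn_ge0.
  by rewrite (@big_cat_nat _ _ _ k0 0 n.+1)//= lerDr sumr_ge0// => k _; rewrite exprn_ge0.
rewrite -[leRHS]mul1r ler_pdivlMr; last by lra.
elim: n {LB} => [|n IH]; first by rewrite big_nat1 expr0; lra.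
have E2 m : (\sum_(0 <= k < m) (2 * b) ^+ k) * (1 - 2 * b) = 1 - (2 * b) ^+ m.
  elim: m => [|m IHm]; first by rewrite big_geq// mul0r expr0 subrr.
  by rewrite big_nat_recr//= mulrDl IHm exprS; ring.
by rewrite E2 gerBl exprn_ge0.
Qed.

(** Simple functions are presented as lists of weighted sets, the form in which
    the second moment argument of [strip_union_ge] produces them. *)
Let step (M : seq (R * set plane)) (z : plane) : R := \sum_(x <- M) x.1 * \1_(x.2) z.

Lemma integral_weighted_indic (M : seq (R * set plane)) :
  (forall x, x \in M -> 0 <= x.1 /\ measurable x.2) ->
  [/\ measurable_fun setT (step M), forall z, 0 <= step M z &
  (\int[leb \x leb]_z (step M z)%:E =
   \sum_(x <- M) x.1%:E * planar_lebesgue x.2)%E].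
Proof.
elim: M => [|x M IH] hM.
  have -> : step [::] = cst 0 by apply/funext => z; rewrite /step big_nil.
  by split => //; rewrite ?big_nil ?integral0.
have [x0 mx] := hM x (mem_head _ _).
have [|mM M0 iM] := IH; first by move=> y yM; apply: hM; rewrite inE yM orbT.
have mi : measurable_fun setT (\1_(x.2) : plane -> R) by exact: measurable_indic.
have mxi : measurable_fun setT (fun z : plane => x.1 * \1_(x.2) z).
  exact: measurable_funM.
have -> : step (x :: M) = (fun z => x.1 * \1_(x.2) z + step M z).
  by apply/funext => z; rewrite /step big_cons.
have i0 z : 0 <= x.1 * \1_(x.2) z by rewrite mulr_ge0.
split; first exact: measurable_funD.
  by move=> z; rewrite addr_ge0.
under eq_integral do rewrite EFinD.
rewrite ge0_integralD//=.
- rewrite big_cons iM; congr (_ + _)%E.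
  under eq_integral do rewrite EFinM.
  rewrite ge0_integralZl//.
  + by rewrite integral_indic// setIT.
  + exact/measurable_EFinP.
- by move=> z _; rewrite lee_fin.
- exact/measurable_EFinP.
- by move=> z _; rewrite lee_fin.
- exact/measurable_EFinP.
Qed.

Lemma weighted_indic_le (M1 M2 : seq (R * set plane)) :
  (forall x, x \in M1 -> 0 <= x.1 /\ measurable x.2) ->
  (forall x, x \in M2 -> 0 <= x.1 /\ measurable x.2) ->
  (forall z, \sum_(x <- M1) x.1 * \1_(x.2) z <= \sum_(x <- M2) x.1 * \1_(x.2) z) ->
  (\sum_(x <- M1) x.1%:E * planar_lebesgue x.2 <=
   \sum_(x <- M2) x.1%:E * planar_lebesgue x.2)%E.
Proof.
move=> h1 h2 h12.
have [m1 p1 <-] := integral_weighted_indic h1.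
have [m2 p2 <-] := integral_weighted_indic h2.
apply: ge0_le_integral => //=.
- by move=> z _; rewrite lee_fin.
- exact/measurable_EFinP.
- exact/measurable_EFinP.
- by move=> z _; rewrite lee_fin; exact: h12.
Qed.

End energy.

(** * Positivity of the area of the sum *)

Section positive_sum.
Context {R : realType}.
Local Notation plane := (measurableTypeR R * measurableTypeR R)%type.
Local Notation leb := (@lebesgue_measure R).
Local Notation gamma := (@gamma R).
Local Notation lip := (@lip R).
Implicit Types (p q z : R * R) (n k : nat) (E K : set (R * R)).

(** Second moment method for Phi = sum_x w_x 1_(strip x): integrating 2 Phi <=
    t Phi^2 + t^-1 1_K with t the inverse of 128 lip r times the energy bound,
    the left-hand side is at least 2 r kappa and the first term on the right at
    most r kappa. *)
Lemma strip_union_ge E K (L : seq (R * (R * R))) k0 n (b kappa : R) :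
  (k0 <= n)%N -> 0 <= b -> 2 * b < 1 -> nonneg_on E L -> 0 < kappa ->
  mass L xpredT = kappa ->
  (forall k c, (k0 <= k <= n)%N -> mass L (fun q => cell k q == c) <= b ^+ k) ->
  measurable (K : set plane) -> (planar_lebesgue K < +oo)%E ->
  (forall p, E p -> strip (2^-1 ^+ n) p `<=` K) ->
  ((kappa / (128 * lip * (2 ^+ k0 * kappa + 9 / (1 - 2 * b))))%:E
    <= planar_lebesgue K)%E.
Proof.
move=> kn b0 b1 L0 kappa0 Lk LB mK Kfin stripK.
have l1 : 1 <= lip := lip_ge1.
set r : R := 2^-1 ^+ n; have r0 : 0 < r by exact: half_exp_gt0.
set Q := 2 ^+ k0 * kappa + _.
have Q0 : 0 < Q.
  by rewrite /Q ltr_wpDr ?divr_ge0 ?mulr_gt0 ?exprn_gt0//; lra.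
set K0 := 128 * lip.
have K00 : 0 < K0 by rewrite /K0; lra.
pose t := (K0 * r * Q)^-1.
have t0 : 0 < t by rewrite invr_gt0 (mulr_gt0 (mulr_gt0 K00 r0) Q0).
pose M1 : seq (R * set plane) := [seq (2 * x.1, strip r x.2) | x <- L].
pose M2 : seq (R * set plane) := (t^-1, K) ::
  [seq (t * (x.1 * y.1), strip r x.2 `&` strip r y.2) | x <- L, y <- L].
have hM1 x : x \in M1 -> 0 <= x.1 /\ measurable x.2.
  move=> /mapP[y /L0[y0 _] ->] /=.
  by split; [rewrite mulr_ge0|exact: strip_measurable].
have hM2 x : x \in M2 -> 0 <= x.1 /\ measurable x.2.
  rewrite inE => /predU1P[->/=|/allpairsP[[y y'] /= [/L0[y0 _] /L0[y'0 _] ->]]].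
    by split => //; rewrite invr_ge0 ltW.
  split => /=; first by rewrite !mulr_ge0// ltW.
  by apply: measurableI; exact: strip_measurable.
have pointwise z : \sum_(x <- M1) x.1 * \1_(x.2) z <= \sum_(x <- M2) x.1 * \1_(x.2) z.
  pose u := \sum_(x <- L) x.1 * \1_(strip r x.2) z : R.
  have -> : \sum_(x <- M1) x.1 * \1_(x.2) z = 2 * u.
    by rewrite big_map mulr_sumr; apply: eq_bigr => x _; rewrite mulrA.
  rewrite big_cons big_allpairs_dep/=.
  have -> : \sum_(x <- L) \sum_(y <- L)
      t * (x.1 * y.1) * \1_(strip r x.2 `&` strip r y.2) z = t * (u * u).
    rewrite big_distrlr/= mulr_sumr; apply: eq_bigr => x _.
    rewrite mulr_sumr; apply: eq_bigr => y _.
    by rewrite indicI/=; ring.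
  have [zK|zK] := pselect (K z).
    rewrite [X in _ * X + _]indicE mem_set// mulr1.
    have : 0 <= t^-1 * (t * u - 1) ^+ 2 by rewrite mulr_ge0 ?sqr_ge0// invr_ge0 ltW.
    have -> : t^-1 * (t * u - 1) ^+ 2 = t^-1 + t * (u * u) - 2 * u.
      by field; rewrite gt_eqF.
    by lra.
  have -> : u = 0.
    rewrite /u big_seq big1// => x /L0[_ Ex]; rewrite indicE memNset ?mulr0//.
    by move=> /(stripK _ Ex).
  by rewrite indicE memNset// !mulr0 addr0.
have := weighted_indic_le hM1 hM2 pointwise.
have low : ((2 * r * kappa)%:E <= \sum_(x <- M1) x.1%:E * planar_lebesgue x.2)%E.
  rewrite big_map -Lk /mass mulr_sumr -sumEFin big_seq [leRHS]big_seq.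
  apply: lee_sum => x /L0[x0 _] /=.
  have -> : 2 * r * x.1 = 2 * x.1 * r by ring.
  by rewrite EFinM; apply: lee_wpmul2l; [rewrite lee_fin mulr_ge0|exact: strip_ge].
have up : (\sum_(x <- M2) x.1%:E * planar_lebesgue x.2 <=
    (t^-1)%:E * planar_lebesgue K + (r * kappa)%:E)%E.
  rewrite big_cons big_allpairs_dep/= leeD2l//.
  apply: (@le_trans _ _ (\sum_(x <- L) \sum_(y <- L)
      (t * K0 * r ^+ 2 * (x.1 * (y.1 * dyadic_kernel k0 n x.2 y.2)))%:E)%E).
    rewrite big_seq [leRHS]big_seq; apply: lee_sum => x /L0[x0 _].
    rewrite big_seq [leRHS]big_seq; apply: lee_sum => y /L0[y0 _].
    have -> : t * K0 * r ^+ 2 * (x.1 * (y.1 * dyadic_kernel k0 n x.2 y.2)) =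
      t * (x.1 * y.1) * (K0 * r ^+ 2 * dyadic_kernel k0 n x.2 y.2) by ring.
    rewrite [leRHS]EFinM; apply: lee_wpmul2l; first by rewrite lee_fin !mulr_ge0// ltW.
    exact: strip_meet_kernel.
  under eq_bigr do rewrite sumEFin.
  rewrite sumEFin lee_fin.
  have rE : r * kappa = t * K0 * r ^+ 2 * (kappa * Q).
    by rewrite /t; field; rewrite !gt_eqF.
  rewrite rE.
  under eq_bigr do rewrite -mulr_sumr -mulr_sumr.
  rewrite -mulr_sumr ler_wpM2l//.
    by rewrite mulr_ge0 ?sqr_ge0// mulr_ge0// ltW.
  rewrite -Lk {1}/mass mulr_suml big_seq [leRHS]big_seq.
  apply: ler_sum => x /L0[x0 _]; rewrite ler_wpM2l//.
  rewrite /Q -Lk; exact: energy_bound L0 LB.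
move=> /(le_trans low)/le_trans/(_ up).
have Kfn : planar_lebesgue K \is a fin_num by rewrite ge0_fin_numE// measure_ge0.
rewrite -(fineK Kfn) -EFinM -EFinD !lee_fin => h.
have {}h : r * kappa <= t^-1 * fine (planar_lebesgue K) by lra.
rewrite ler_pdivrMr; last exact: mulr_gt0 K00 Q0.
rewrite -(ler_pM2l r0); apply: (le_trans h).
by rewrite /t invrK le_eqVlt; apply/orP; left; apply/eqP; ring.
Qed.

(** The thickening is a continuous image of E * [1, 2] * [-r, r]. *)
Lemma sum_thickening E (r : R) :
  compact E -> compact [set z + (0, y) | z in
    minkowski_sum E (graph_over gamma `[1, 2]%classic) & y in `[- r, r]%classic].
Proof.
move=> cE.
pose f (w : (R * R) * R * R) : R * R := (w.1.1.1 + w.1.2, w.1.1.2 + gamma w.1.2 + w.2).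
have cf : continuous f.
  move=> w; apply: (@cvg_pair _ _ _ _ (nbhs (w.1.1.1 + w.1.2))
      (nbhs (w.1.1.2 + gamma w.1.2 + w.2))).
    apply: cvgD.
      by apply: cvg_comp; [apply: cvg_comp;
        [exact: cvg_fst|exact: cvg_fst]|exact: cvg_fst].
    by apply: cvg_comp; [exact: cvg_fst|exact: cvg_snd].
  apply: cvgD; last exact: cvg_snd.
  apply: cvgD.
    by apply: cvg_comp; [apply: cvg_comp; [exact: cvg_fst|exact: cvg_fst]|exact: cvg_snd].
  apply: (@cvg_comp _ _ _ (fun w : (R * R) * R * R => w.1.2) gamma _ (nbhs w.1.2)).
    by apply: cvg_comp; [exact: cvg_fst|exact: cvg_snd].
  exact: gamma_continuous.
have -> : [set z + (0, y) | z in minkowski_sum E (graph_over gamma `[1, 2]%classic)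
      & y in `[- r, r]%classic] = f @` ((E `*` `[1, 2]%classic) `*` `[- r, r]%classic).
  apply/seteqP; split => [_ [_ [e Ee [_ [x x12 <-] <-]] [y yr <-]]|
      _ [[[e x] y] [[/= Ee x12] yr] <-]].
    exists (e, x, y) => //; rewrite /f/=; congr pair => //=.
    by rewrite addr0.
  exists (e + (x, gamma x)); first by exists e => //; exists (x, gamma x) => //; exists x.
  exists y => //; rewrite /f/=; congr pair => /=.
  by rewrite addr0.
apply: continuous_compact; first exact: continuous_subspaceT.
apply: compact_setX; last exact: segment_compact.
by apply: compact_setX => //; exact: segment_compact.
Qed.

(** The strips around the points of E of width 2^-n lie in the vertical
    2^-n-neighborhood of the sum; these compact neighborhoods decrease to the
    sum and their areas are bounded below by [strip_union_ge]. *)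
Theorem positive_sum E : compact E -> (1%:E < hausdorff_dim E)%E ->
  (0 < planar_lebesgue (minkowski_sum E (graph_over gamma `[1%R, 2%R]%classic)))%E.
Proof.
move=> cE dE.
have [s s1 sE] : exists2 s : R, 1 < s & (0 < hausdorff s E)%E.
  have [s s1 sd] : exists2 s : R, 1 < s & (s%:E < hausdorff_dim E)%E.
    move: dE; case: (hausdorff_dim E) => [d||//]; rewrite ?lte_fin => d1.
      by exists ((1 + d) / 2); rewrite ?lte_fin; lra.
    by exists 2; rewrite ?ltry//; lra.
  exists s => //; rewrite lt_neqAle hausdorff_ge0 andbT; apply/eqP => h.
  move: sd; rewrite ltNge => /negP; apply; apply: ereal_inf_lbound.
  by exists s => //; split => //; lra.
have s0 : 0 < s by lra.
have [k0 [kappa [kappa0 hL]]] := finite_frostman s0 sE.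
set b : R := 2^-1 `^ s in hL.
have b0 : 0 < b by rewrite powR_gt0.
have b1 : 2 * b < 1.
  by have := half_powR_lt s1; rewrite -/b; lra.
pose S := minkowski_sum E (graph_over gamma `[1, 2]%classic).
pose Sn n := [set z + (0, y) | z in S & y in `[- (2^-1 ^+ n), 2^-1 ^+ n]%classic].
have cSn n : compact (Sn n) by exact: sum_thickening.
have SE : S = [set z + (0, y) | z in S & y in `[- (0 : R), 0]%classic].
  apply/seteqP; split => [z Sz|_ [z Sz [y + <-]]].
    exists z => //; exists 0; first by rewrite /= in_itv/= oppr0 lexx.
    by rewrite -[RHS]addr0.
  rewrite /= in_itv/= oppr0 => /andP[y0 y1].
  have -> : y = 0 by apply/le_anti; rewrite y0 y1.
  by rewrite (_ : z + (0, 0) = z)// -[RHS]addr0.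
have clS : closed S.
  by apply: compact_closed; [exact: norm_hausdorff|rewrite SE; exact: sum_thickening].
have Scap : \bigcap_n Sn n = S.
  apply/seteqP; split => [z hz|z Sz n _]; last first.
    exists z => //; exists 0; last by rewrite -[RHS]addr0.
    by rewrite /= in_itv/= oppr_le0 half_exp_ge0.
  apply: clS => U /nbhs_ballP[e /= e0 he].
  have [m /(_ m (leqnn m)) hm] := half_expn_lt e0.
  have [w Sw [y + wz]] := hz m I; rewrite /= in_itv/= -ler_norml => ym.
  exists w; split => //; apply: he; rewrite -wz; split => /=.
    by rewrite /ball/= addr0 subrr normr0.
  by rewrite /ball/= addrAC subrr add0r (le_lt_trans ym).
have mS : measurable (S : set plane) by exact: closed_plane_measurable.
have mSn n : measurable (Sn n : set plane) by exact: compact_plane_measurable.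
pose c0 := kappa / (128 * lip * (2 ^+ k0 * kappa + 9 / (1 - 2 * b))).
have l1 : 1 <= lip := lip_ge1.
have c00 : 0 < c0.
  by rewrite divr_gt0// mulr_gt0 ?ltr_wpDr ?divr_ge0 ?mulr_gt0 ?exprn_gt0//; lra.
have ge n : (k0 <= n)%N -> (c0%:E <= planar_lebesgue (Sn n))%E.
  move=> kn; have [L [L0 Lk LB]] := hL (n - k0)%N.
  apply: (strip_union_ge (b := b) (E := E) (L := L) kn) => //.
  - exact: ltW.
  - by move=> k c kk; apply: LB; rewrite subnKC.
  - exact: compact_plane_finite.
  move=> p Ep z [cz hz]; exists (p + (z.1 - p.1, gamma (z.1 - p.1))).
    exists p => //; exists (z.1 - p.1, gamma (z.1 - p.1)) => //.
    by exists (z.1 - p.1) => //; case: cz.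
  exists (z.2 - (p.2 + gamma (z.1 - p.1))); first by rewrite /= in_itv/= -ler_norml.
  case: z {cz hz} => z1 z2 /=; congr pair => /=; first by rewrite addr0 addrC subrK.
  by rewrite addrC subrK.
have cv : (leb \x leb)%E (Sn n) @[n --> \oo] --> (leb \x leb)%E (\bigcap_n Sn n).
  apply: nonincreasing_cvg_mu => //.
  - exact: compact_plane_finite.
  - by rewrite Scap.
  move=> m n mn; apply/subsetPset => z [w Sw [y + wz]].
  rewrite /= in_itv/= => /andP[y1 y2]; exists w => //; exists y => //.
  have mn' : 2^-1 ^+ n <= 2^-1 ^+ m :> R.
    by rewrite ler_wiXn2l ?invr_ge0 ?invf_le1 ?ler1n.
  by rewrite /= in_itv/=; apply/andP; split; lra.
rewrite Scap in cv.
apply: (@lt_le_trans _ _ c0%:E); first by rewrite lte_fin.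
rewrite -/S.
have <- : limn (fun n => planar_lebesgue (Sn n)) = planar_lebesgue S by apply/cvg_lim.
apply: lime_ge; first by apply/cvg_ex; eexists; exact: cv.
by exists k0 => // n /= kn; exact: ge.
Qed.

End positive_sum.

(** * The theorem *)

Theorem theorem1p1 (R : realType) :
  exists gamma1 : R -> R,
    [/\ strictly_convex_on `[1, 2] gamma1,
        [lipschitz gamma1 x | x in `[1, 2]],
        sum_threshold (graph_over gamma1 `[1, 2]) = 1%E,
        (forall (I : interval R) (alpha : R),
           [set` I] `<=` `[1, 2] -> (0 < lebesgue_measure [set` I])%E ->
           0 < alpha ->
           limf_esup (fun xi : R * R =>
             (enorm xi `^ alpha *
              ComplexField.Normc.normc (fourier (arclength gamma1 [set` I]) xi))%:E)
             enorm_infty = +oo%E) &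
        (forall (I : interval R) (alpha : R),
           [set` I] `<=` `[1, 2] ->
           (0 < hausdorff 1 (graph_over gamma1 [set` I]))%E ->
           0 < alpha ->
           ~ fourier_decay alpha (arclength gamma1 [set` I]))].
Proof.
exists (@gamma R); split.
- exact: gamma_strictly_convex.
- exists (@lip R); split; first exact: num_real.
  move=> M lM [x y] _ /=; apply: (le_trans (gamma_lipschitz x y)).
  by rewrite ler_wpM2r// ltW.
- apply/eqP; rewrite eq_le; apply/andP; split.
    apply: ereal_inf_lbound; exists 1 => // E cE dE; exact: positive_sum.
  apply: le_ereal_inf_tmp => _ [t ht <-]; rewrite lee_fin leNgt; apply/negP => t1.
  have [E [cE dE sum0]] := small_set_null_sum t1.
  by have := ht E cE dE; rewrite sum0 ltxx.
- move=> I alpha I12 I0 a0; apply: limf_esup_decay.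
  have [[c [d [Ic Id cd]]]|[x Ix]] := interval_two_points I.
    exact: arclength_no_decay I12 Ic Id cd a0.
  suff : (lebesgue_measure [set` I] <= 0)%E by rewrite leNgt I0.
  rewrite -(lebesgue_measure_set1 x); apply: le_measure; rewrite ?inE//.
- move=> I alpha I12 I0 a0.
  have [[c [d [Ic Id cd]]]|[x Ix]] := interval_two_points I.
    exact: arclength_no_decay I12 Ic Id cd a0.
  suff : (hausdorff 1 (graph_over (@gamma R) [set` I]) <= 0)%E by rewrite leNgt I0.
  rewrite -(hausdorff_point (x, gamma x)); apply: le_hausdorff => _ [y /Ix -> <-].
  by [].
Qed.
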